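(* Let $(X, \mathcal{C})$ be a uniformly locally finite coarse space. Then the following conditions are equivalent: (1) $X$ has property A; (2) for every $\epsilon > 0$ and every $T \in \mathcal{C}$, there exists a map $\eta \colon X \to \ell^2(X)$, $x \mapsto \eta_x$, assigning unit vectors, such that $\|\eta_x - \eta_y\| < \epsilon$ whenever $(x,y) \in T$, and the set $\{(x,y) \in X^2 : y \in \mathrm{supp}(\eta_x)\}$ is controlled; (3) for every $\epsilon > 0$ and every $T \in \mathcal{C}$, there exist a Hilbert space $\mathcal{H}$ and a map $\eta \colon X \to \mathcal{H}$, $x \mapsto \eta_x$, assigning unit vectors, such that $\|\eta_x - \eta_y\| < \epsilon$ whenever $(x,y) \in T$, and the set $\{(x,y) \in X^2 : \langle \eta_y, \eta_x \rangle \neq 0\}$ is controlled; (4) for every $\epsilon > 0$ and every $T \in \mathcal{C}$, there exists a positive definite kernel $k \colon X^2 \to \mathbb{C}$ such that $|1 - k(x,y)| < \epsilon$ whenever $(x,y) \in T$, and the set $\{(x,y) \in X^2 : k(x,y) \neq 0\}$ is controlled.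
   Context: For subsets $T, T_1, T_2 \subset X^2$ of the square of a set $X$, write $T^{-1} = \{(x,y) : (y,x) \in T\}$, $T_1 \circ T_2 = \{(x,y) : \exists z \in X,\ (x,z) \in T_1,\ (z,y) \in T_2\}$, and for $x \in X$ write $T[x] = \{y \in X : (y,x) \in T\}$. A coarse structure on $X$ is a family $\mathcal{C}$ of subsets of $X^2$ that contains the diagonal $\Delta_X = \{(x,x) : x \in X\}$ and is closed under $T \mapsto T^{-1}$, under $(T_1,T_2) \mapsto T_1 \circ T_2$, under $(T_1,T_2) \mapsto T_1 \cup T_2$, and under passing to subsets. The pair $(X,\mathcal{C})$ is called a coarse space (it need not be connected or metrizable), and elements of $\mathcal{C}$ are called controlled sets. $(X,\mathcal{C})$ is uniformly locally finite if $\sup_{x \in X} \sharp(T[x]) < \infty$ for every $T \in \mathcal{C}$. A uniformly locally finite coarse space $(X,\mathcal{C})$ has property A if for every $\epsilon > 0$ and every $T \in \mathcal{C}$ there exist $S \in \mathcal{C}$ and a subset $A \subset S \times \mathbb{N}$ (with $\mathbb{N} = \{1,2,\dots\}$) such that, writing $A_x = \{(y,n) \in X \times \mathbb{N} : (x,y,n) \in A\}$: (i) $A_x$ is finite for every $x \in X$; (ii) $\Delta_X \times \{1\} \subset A$; (iii) $\sharp(A_x \bigtriangleup A_y) < \epsilon\, \sharp(A_x \cap A_y)$ whenever $(x,y) \in T$, where $\bigtriangleup$ denotes symmetric difference. A function $k \colon X^2 \to \mathbb{C}$ is a positive definite kernel if $\sum_{i,j=1}^n \overline{\lambda_i} \lambda_j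 k(x_i,x_j) \ge 0$ for all $n$, all $x_1,\dots,x_n \in X$ and all $\lambda_1,\dots,\lambda_n \in \mathbb{C}$. *)

(* Defs.v *)
From HB Require Import structures.
From mathcomp Require Import all_boot all_order all_algebra.
From mathcomp Require Import sesquilinear complex finmap.
From mathcomp Require Import all_classical all_reals all_analysis.

Set Implicit Arguments.
Unset Strict Implicit.
Unset Printing Implicit Defensive.

Import Order.TTheory GRing.Theory Num.Theory.
Import numFieldNormedType.Exports.

Local Open Scope classical_set_scope.
Local Open Scope complex_scope.
Local Open Scope ring_scope.

(* The library's [B \; A] is [set xy | exists2 z, A (xy.1, z) & B (z, xy.2)],
   so the relation {(x, y) | exists z, (x, z) \in T1 and (z, y) \in T2} is
   [T2 \; T1]. *)
Record coarse_structure (X : choiceType) (C : set (set (X * X))) : Prop := {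
  coarse_diagonal : C diagonal;
  coarse_inverse : forall T, C T -> C (T^-1)%relation;
  coarse_compose : forall T1 T2, C T1 -> C T2 -> C (T2 \; T1)%relation;
  coarse_union : forall T1 T2, C T1 -> C T2 -> C (T1 `|` T2);
  coarse_subset : forall T1 T2, T1 `<=` T2 -> C T2 -> C T1
}.

(* [ysection T x] is T[x] = {y | (y, x) \in T}; a finite supremum of the
   cardinals is a uniform bound N on them. *)
Definition uniformly_locally_finite (X : choiceType) (C : set (set (X * X))) :=
  forall T, C T -> exists N : nat, forall x, (ysection T x #<= `I_N)%card.

Definition fiber (X : choiceType) (A : set (X * X * nat)) (x : X) :
  set (X * nat) := [set yn | A (x, yn.1, yn.2)].

(* The positive integers are encoded as the elements of [set n : nat | 0 < n],
   which contains the last component of every element of A.  The cardinals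
   [#|` fset_set _|] are meaningful because the fibers of A are finite. *)
Definition property_A (R : realType) (X : choiceType)
    (C : set (set (X * X))) : Prop :=
  forall (e : R) (T : set (X * X)), 0 < e -> C T ->
  exists (S : set (X * X)) (A : set (X * X * nat)),
    [/\ C S, A `<=` S `*` [set n : nat | (0 < n)%N],
        forall x, finite_set (fiber A x),
        diagonal `*` [set 1%N] `<=` A &
        forall x y, T (x, y) ->
          (#|` fset_set (fiber A x `+` fiber A y)|)%:R
            < e * (#|` fset_set (fiber A x `&` fiber A y)|)%:R].

Section l2.
Variables (R : realType) (X : choiceType).
Implicit Type f : X -> R[i].

Definition l2_sqnorm f : \bar R :=
  \esum_(x in [set: X]) ((ComplexField.Normc.normc (f x)) ^+ 2)%:E.

Definition l2 : set (X -> R[i]) := [set f | (l2_sqnorm f < +oo)%E].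

Definition l2_norm f : R := Num.sqrt (fine (l2_sqnorm f)).

End l2.

(* The norm of a [normedModType R[i]] takes its values in R[i]; the order of
   R[i] is the partial one, for which 0 <= z means that z is real and
   nonnegative.  The inner product is linear in its first argument. *)
Record hilbertSpace (R : realType) := HilbertSpace {
  hilbert_sort :> completeNormedModType R[i];
  inner : {dot hilbert_sort for Num.conj};
  inner_norm : forall u : hilbert_sort, `|u| ^+ 2 = inner u u
}.

Definition positive_definite_kernel (R : realType) (X : choiceType)
    (k : X * X -> R[i]) : Prop :=
  forall (n : nat) (x : 'I_n -> X) (l : 'I_n -> R[i]),
    0 <= \sum_(i < n) \sum_(j < n) (l i)^* * l j * k (x i, x j).

(* Main.v *)
Require Import Defs.
From HB Require Import structures.
From mathcomp Require Import all_boot all_order all_algebra.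
From mathcomp Require Import sesquilinear complex finmap.
From mathcomp Require Import ring lra zify.
From mathcomp Require Import all_classical all_reals all_analysis.
From mathcomp Require summability.

Set Implicit Arguments.
Unset Strict Implicit.
Unset Printing Implicit Defensive.

Import Order.TTheory GRing.Theory Num.Theory.
Import numFieldNormedType.Exports.

Local Open Scope classical_set_scope.
Local Open Scope complex_scope.
Local Open Scope ring_scope.

(** The implications form a cycle, of which the last one is the substantial one.

    From property A to unit vectors ([unit_vectors_of_property_A]): push the
    uniform distribution on A_x forward to X and take the square root of its
    density.  Unit vectors in l2 are unit vectors in a Hilbert space, once l2 is
    known to be one ([l2hilbert]), and Gram matrices of unit vectors are positive
    definite kernels ([kernel_of_hilbert_vectors]).

    From a positive definite kernel k with controlled support to property A.  By
    uniform local finiteness, k acts on finitely supported functions as a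
    positive operator K that is bounded above by a constant M ([pd_schur]).  If S
    is the positive square root of K / M, the vectors S delta_x have Gram matrix
    k / M, hence are almost invariant, but S need not have controlled propagation.
    A polynomial in K has it.  The operator A = 1 - K / M satisfies 0 <= A <= 1,
    and the iteration Q_{n+1} = (A + Q_n^2) / 2 started at 0 produces polynomials
    in A such that (1 - Q_n)^2 approximates K / M in norm
    ([approximate_sqrt]).  The estimate compares the iteration with its value at
    A = 1 and uses no spectral theory; it holds on any complex inner product
    space, so that it applies directly to the incomplete space of finitely
    supported functions.  The vectors b x = (1 - Q_n) delta_x then have controlled
    supports and are almost invariant ([almost_invariant_vectors_of_kernels]).

    Finally |b x|^2, scaled by a large factor and rounded to natural numbers,
    becomes the height of a finite set A_x over X, and the almost invariance of b
    in l2 gives that of |b x|^2 in l1, which is property A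
    ([property_A_of_vectors]). *)

(** * Inner product spaces and square roots of positive operators *)

(** A quadratic that is nonnegative on the whole complex plane has a nonpositive
    discriminant: restrict it to the ray spanned by - b^*, where it becomes a
    real quadratic in r, and take r = 1 / a, or r large when a = 0. *)
Lemma discriminant_le (C : numClosedFieldType) (a b c : C) :
  0 <= a -> 0 <= c ->
  (forall s : C, 0 <= `|s| ^+ 2 * a + (s * b + (s * b)^*) + c) ->
  `|b| ^+ 2 <= a * c.
Proof.
move=> a0 c0 H.
have H1 (r : C) : 0 <= r -> 0 <= r ^+ 2 * `|b| ^+ 2 * a - 2 * r * `|b| ^+ 2 + c.
  move=> r0; have := H (- r * b^*).
  have -> : - r * b^* * b = - r * `|b| ^+ 2 by rewrite -mulrA [b^* * b]mulrC -normCK.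
  have /CrealP -> : - r * `|b| ^+ 2 \is Num.real.
    by rewrite realM // ?realN ?ger0_real ?exprn_ge0.
  rewrite normrM normrN norm_conjC (ger0_norm r0).
  by apply: etrans; congr (0 <= _); ring.
have [a1|a1] := eqVneq a 0.
  rewrite a1 mul0r; have [->|b0] := eqVneq b 0; first by rewrite normr0 expr0n.
  have nb : `|b| ^+ 2 != 0 by rewrite expf_neq0 // normr_eq0.
  have := H1 ((c + 1) / (2 * `|b| ^+ 2)); rewrite a1 mulr0 add0r.
  have -> : - (2 * ((c + 1) / (2 * `|b| ^+ 2)) * `|b| ^+ 2) + c = - 1.
    by field; rewrite normr_eq0.
  have r0 : 0 <= (c + 1) / (2 * `|b| ^+ 2).
    by rewrite divr_ge0 ?addr_ge0 ?mulr_ge0 ?exprn_ge0.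
  by move=> /(_ r0); rewrite lerNr oppr0 ler10.
have a2 : 0 < a by rewrite lt_def a1.
have := H1 a^-1; rewrite invr_ge0 => /(_ a0).
have -> : a^-1 ^+ 2 * `|b| ^+ 2 * a - 2 / a * `|b| ^+ 2 + c =
    (a * c - `|b| ^+ 2) / a by field.
by rewrite pmulr_lge0 ?invr_gt0 // subr_ge0.
Qed.

Section Dot.
Variables (C : numClosedFieldType) (U : lmodType C) (form : {dot U for Num.conj}).
Local Notation "''[' u , v ]" := (form u%R v%R) : ring_scope.
Local Notation "''[' u ]" := '[u, u]%R : ring_scope.
Local Notation "`[ u ]" := (sqrtC '[u]) (at level 0, format "`[ u ]") : ring_scope.

Lemma dot_conjC u v : '[u, v]^* = '[v, u].
Proof. by rewrite [RHS]hermC mul1r. Qed.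

(** Cauchy-Schwarz for the possibly degenerate form [<A u, v>].  It is used with
    A = id, and with a genuinely degenerate A to bound the norm of A itself. *)
Lemma psd_Cauchy_Schwarz (A : {linear U -> U}) u v :
  (forall u v, '[A u, v] = '[u, A v]) -> (forall u, 0 <= '[A u, u]) ->
  `|'[A u, v]| ^+ 2 <= '[A u, u] * '[A v, v].
Proof.
move=> adjA A0; apply: discriminant_le => // s.
have := A0 (s *: u + v).
have -> : A (s *: u + v) = s *: A u + A v by rewrite linearD linearZ.
have linr w : '[w, s *: u + v] = s^* * '[w, u] + '[w, v].
  by rewrite linearDr linearZr_LR.
rewrite linearPl /= !linr.
rewrite [in '[A v, u]]adjA -[in '[v, A u]]dot_conjC rmorphM /= normCK.
by apply: etrans; congr (0 <= _); ring.
Qed.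

Lemma dot_Cauchy_Schwarz u v : `|'[u, v]| <= `[u] * `[v].
Proof.
rewrite -sqrtCM ?nnegrE ?dnorm_ge0 // -[leLHS]sqrCK //.
rewrite ler_sqrtC ?nnegrE ?exprn_ge0 ?mulr_ge0 ?dnorm_ge0 //.
by apply: (psd_Cauchy_Schwarz (A := idfun)) => // w; exact: dnorm_ge0.
Qed.

Lemma dot_triangle u v : `[u + v] <= `[u] + `[v].
Proof.
rewrite -(@ler_pXn2r _ 2) ?nnegrE ?addr_ge0 ?sqrtC_ge0 ?dnorm_ge0 //.
rewrite sqrrD !sqrtCK dnormD [leRHS]addrAC lerD2l.
have := dot_Cauchy_Schwarz u v; set d := '[u, v] => dle.
have -> : d + d^* = 'Re d *+ 2.
  by rewrite -mulr_natr ReE divfK // pnatr_eq0.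
rewrite lerMn2r /=; apply: le_trans dle.
by have [] := leif_Re_Creal d.
Qed.

Section SquareRoot.
Variable A : {linear U -> U}.
Hypothesis adjA : forall u v, '[A u, v] = '[u, A v].
Hypothesis A_ge0 : forall u, 0 <= '[A u, u].
Hypothesis A_le1 : forall u, '[A u, u] <= '[u].

(** Cauchy-Schwarz for <A u, v>: ||A u||^4 = |<A u, A u>|^2 is at most
    <A u, u> <A (A u), A u> <= ||u||^2 ||A u||^2. *)
Lemma psd_contraction u : `[A u] <= `[u].
Proof.
rewrite ler_sqrtC ?nnegrE ?dnorm_ge0 //.
have [->|Au0] := eqVneq (A u) 0; first by rewrite linear0l dnorm_ge0.
have Au_gt0 : 0 < '[A u] by rewrite dnorm_gt0.
have := psd_Cauchy_Schwarz u (A u) adjA A_ge0.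
rewrite ger0_norm ?dnorm_ge0 // expr2 => h.
rewrite -(ler_pM2r Au_gt0); apply: le_trans h _.
by rewrite ler_pM.
Qed.

(** The iteration Q_0 = 0, Q_{n+1} = (A + Q_n^2) / 2, due to Visser, which
    converges to 1 - sqrt (1 - A).  It involves sums and products only, so that
    each step enlarges the propagation of A in a controlled way. *)
Fixpoint visser n (u : U) : U :=
  if n is n'.+1 then 2^-1 *: (A u + visser n' (visser n' u)) else 0.

(** The same iteration at A = 1.  Every Q_n is a polynomial in A with
    nonnegative coefficients, whence its value at 1 bounds the norm of Q_n. *)
Fixpoint visser_bound n : C :=
  if n is n'.+1 then 2^-1 * (1 + visser_bound n' ^+ 2) else 0.

Lemma visserD n u v : visser n (u + v) = visser n u + visser n v.
Proof.
elim: n u v => [|n IH] u v /=; first by rewrite addr0.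
by rewrite !IH [A _]linearD -scalerDr addrACA.
Qed.

Lemma visserN n u : visser n (- u) = - visser n u.
Proof.
elim: n u => [|n IH] u /=; first by rewrite oppr0.
by rewrite !IH [A _]linearN -opprD scalerN.
Qed.

Lemma visserB n u v : visser n (u - v) = visser n u - visser n v.
Proof. by rewrite visserD visserN. Qed.

Lemma visser_adj n u v : '[visser n u, v] = '[u, visser n v].
Proof.
elim: n u v => [|n IH] u v /=; first by rewrite linear0l linear0r.
rewrite [LHS]linearZl_LR [RHS]linearZr_LR /= fmorphV rmorph_nat.
by congr (_ * _); rewrite linearDl linearDr /= adjA !IH.
Qed.

Lemma visser_bound_ge0 n : 0 <= visser_bound n.
Proof.
by elim: n => //= n h; rewrite mulr_ge0 ?invr_ge0 // addr_ge0 // exprn_ge0.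
Qed.

Lemma visser_bound_gapE n : visser_bound n.+1 - visser_bound n = (1 - visser_bound n) ^+ 2 / 2.
Proof. by rewrite /=; field. Qed.

Lemma visser_bound_le1 n : visser_bound n <= 1.
Proof.
elim: n => [|n h] /=; first exact: ler01.
rewrite mulrC ler_pdivrMr // mul1r -[leRHS]/(1 + 1) lerD2l.
by rewrite exprn_ile1 // visser_bound_ge0.
Qed.

Lemma visser_bound_mono n : visser_bound n <= visser_bound n.+1.
Proof.
rewrite -subr_ge0 visser_bound_gapE mulr_ge0 ?invr_ge0 // exprn_ge0 //.
by rewrite subr_ge0 visser_bound_le1.
Qed.

Lemma visser_gap_antimono n :
  visser_bound n.+2 - visser_bound n.+1 <= visser_bound n.+1 - visser_bound n.
Proof.
rewrite !visser_bound_gapE ler_pM2r ?invr_gt0 // lerXn2r ?nnegrE ?subr_ge0 //.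
- exact: visser_bound_le1.
- exact: visser_bound_le1.
by rewrite lerD2l lerN2 visser_bound_mono.
Qed.

(** The gaps decrease and the first n + 1 of them add up to at most 1, hence the
    n-th one is at most 1 / (n + 1). *)
Lemma visser_gap_le n : visser_bound n.+1 - visser_bound n <= n.+1%:R^-1.
Proof.
suff : n.+1%:R * (visser_bound n.+1 - visser_bound n) <= visser_bound n.+1.
  move=> h; rewrite -[leRHS]mul1r ler_pdivlMr // mulrC.
  exact: le_trans h (visser_bound_le1 _).
elim: n => [|n IH]; first by rewrite mul1r subr0.
rewrite -[n.+2%:R]natr1 mulrDl mul1r -lerBrDr opprB addrCA subrr addr0.
apply: le_trans IH; rewrite ler_pM2l //; exact: visser_gap_antimono.
Qed.

Lemma dot_scale_nonneg (r : C) u : 0 <= r -> `[r *: u] = r * `[u].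
Proof.
by move=> r0; rewrite dnormZ sqrtCM ?nnegrE ?exprn_ge0 ?dnorm_ge0 // sqrCK ?ger0_norm.
Qed.

Lemma visser_le n u : `[visser n u] <= visser_bound n * `[u].
Proof.
elim: n u => [|n IH] u; first by rewrite /= linear0l sqrtC0 mul0r.
rewrite /= dot_scale_nonneg ?invr_ge0 // -mulrA ler_pM2l ?invr_gt0 //.
apply: le_trans (dot_triangle _ _) _.
rewrite mulrDl mul1r lerD ?psd_contraction //.
apply: le_trans (IH _) _.
by rewrite expr2 -mulrA ler_wpM2l ?visser_bound_ge0.
Qed.

(** The increments of Q_n are polynomials in A with nonnegative coefficients as
    well, which is why their norm is bounded by their value at 1.  The proof
    uses Q_{n+1}^2 - Q_n^2 = Q_{n+1} (Q_{n+1} - Q_n) + (Q_{n+1} - Q_n) Q_n,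
    which holds whether or not the Q_n commute. *)
Lemma visser_increment_le n u :
  `[visser n.+1 u - visser n u] <= (visser_bound n.+1 - visser_bound n) * `[u].
Proof.
elim: n u => [|n IH] u.
  rewrite /= !subr0 addr0 expr0n addr0 mulr1 dot_scale_nonneg ?invr_ge0 //.
  by rewrite ler_pM2l ?invr_gt0 // psd_contraction.
set d := visser_bound n.+1 - visser_bound n in IH *.
have d0 : 0 <= d by rewrite subr_ge0 visser_bound_mono.
have -> : visser n.+2 u - visser n.+1 u =
    2^-1 *: (visser n.+1 (visser n.+1 u - visser n u)
             + (visser n.+1 (visser n u) - visser n (visser n u))).
  rewrite visserB addrA subrK.
  transitivity (2^-1 *: (A u + visser n.+1 (visser n.+1 u))
                - 2^-1 *: (A u + visser n (visser n u))); first by [].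
  by rewrite -scalerBr opprD addrACA subrr add0r.
have -> : visser_bound n.+2 - visser_bound n.+1 =
    2^-1 * (visser_bound n.+1 * d + d * visser_bound n).
  transitivity (2^-1 * (1 + visser_bound n.+1 ^+ 2)
                - 2^-1 * (1 + visser_bound n ^+ 2)); first by [].
  by rewrite /d; move: (visser_bound n.+1) (visser_bound n) => x y; ring.
rewrite dot_scale_nonneg ?invr_ge0 // -mulrA ler_pM2l ?invr_gt0 //.
apply: le_trans (dot_triangle _ _) _; rewrite mulrDl; apply: lerD.
  apply: le_trans (visser_le _ _) _.
  by rewrite -mulrA ler_wpM2l ?visser_bound_ge0.
apply: le_trans (IH _) _; rewrite -mulrA ler_wpM2l //; exact: visser_le.
Qed.

(** 1 - Q_n is a self-adjoint approximate square root of 1 - A: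
    (1 - Q_n)^2 - (1 - A) = 2 (Q_{n+1} - Q_n), and the increments tend to 0
    in norm. *)
Lemma approximate_sqrt n u v :
  `|'[u - visser n u, v - visser n v] - '[u - A u, v]| <= 2 / n.+1%:R * (`[u] * `[v]).
Proof.
have -> : '[u - visser n u, v - visser n v] - '[u - A u, v] =
          '[2 *: (visser n.+1 u - visser n u), v].
  set w := u - visser n u.
  have -> : '[w, v - visser n v] = '[w - visser n w, v].
    by rewrite linearBr [RHS]linearBl /= visser_adj.
  rewrite -linearBl /w visserB /=; congr (form _ v).
  rewrite scalerBr scalerA mulfV ?pnatr_eq0 // scale1r scaler_nat mulr2n.
  move: (visser n u) (visser n (visser n u)) (A u) => q qq a.
  by rewrite [- (u - a)]opprB addrC !addrA subrK opprB addrACA -opprD.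
apply: le_trans (dot_Cauchy_Schwarz _ _) _.
rewrite dot_scale_nonneg // -!mulrA ler_pM2l // mulrA ler_wpM2r ?sqrtC_ge0 ?dnorm_ge0 //.
apply: le_trans (visser_increment_le _ _) _.
by rewrite ler_wpM2r ?sqrtC_ge0 ?dnorm_ge0 // visser_gap_le.
Qed.
End SquareRoot.
End Dot.

(** * The Hilbert space of square-summable functions *)

Local Notation normc := ComplexField.Normc.normc.

(** The radii of balls over the complex numbers are complex numbers; being
    positive they are real, which brings every estimate back to the reals. *)
Lemma pos_complex_real (R : realType) (e : R[i]) :
  0 < e -> exists2 r : R, e = r%:C & 0 < r.
Proof.
move=> e0; exists (complex.Re e); first by rewrite RRe_real // gtr0_real.
by move: e0; rewrite ltcE => /andP[].
Qed.

Lemma conj_imaginary (R : realType) : ('i%C)^* = - 'i%C :> R[i].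
Proof. by apply/eqP; rewrite eq_complex /= oppr0 !eqxx. Qed.

Section PartialSums.
Variables (R : realType) (X : choiceType).
Implicit Types (f g : X -> R[i]) (F : {fset X}).

Definition sqsum f F : R := \sum_(x <- F) normc (f x) ^+ 2.

Lemma l2_sqnorm_ge0 f : (0 <= l2_sqnorm f)%E.
Proof. by apply: esum_ge0 => x _; rewrite lee_fin sqr_ge0. Qed.

Lemma sqsum_ge0 f F : 0 <= sqsum f F.
Proof. by apply: sumr_ge0 => x _; exact: sqr_ge0. Qed.

Lemma sqsum_fsbig f F :
  (\sum_(x \in [set` F]) (normc (f x) ^+ 2)%:E = (sqsum f F)%:E)%E.
Proof.
by rewrite fsbig_finite //= set_fsetK sumEFin.
Qed.

Lemma sqsum_le_l2 f F : l2 f -> sqsum f F <= fine (l2_sqnorm f).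
Proof.
move=> f2; have f0 := l2_sqnorm_ge0 f.
rewrite -lee_fin fineK ?ge0_fin_numE // -sqsum_fsbig.
by apply: esum_ge; exists [set` F].
Qed.

(** With [sqsum_le_l2], replaces the extended-real sum by bounds on the finite
    partial sums. *)
Lemma l2_bounded f M : (forall F, sqsum f F <= M) ->
  l2 f /\ fine (l2_sqnorm f) <= M.
Proof.
move=> fM; have fle : (l2_sqnorm f <= M%:E)%E.
  apply: ge_ereal_sup => _ [A [finA _] <-].
  by rewrite -(fset_setK finA) sqsum_fsbig lee_fin.
have f0 := l2_sqnorm_ge0 f.
have f2 : (l2_sqnorm f < +oo)%E by apply: le_lt_trans fle _; rewrite ltry.
by split=> //; rewrite -lee_fin fineK ?ge0_fin_numE.
Qed.

Lemma sqsum_mono f F G : (F `<=` G)%fset -> sqsum f F <= sqsum f G.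
Proof.
move=> FG; pose h x := if x \in F then normc (f x) ^+ 2 else 0.
have -> : sqsum f F = \sum_(x <- F) h x.
  by rewrite /sqsum; apply: eq_big_seq => x xF; rewrite /h xF.
rewrite (big_fset_incl _ FG) => [|x _ /negbTE xF]; last by rewrite /h xF.
by apply: ler_sum => x _; rewrite /h; case: ifP => // _; exact: sqr_ge0.
Qed.

Lemma l2_approx f e : l2 f -> 0 < e ->
  exists F, fine (l2_sqnorm f) - e < sqsum f F.
Proof.
move=> f2 e0; apply: contrapT => /forallNP h.
have [|_] := @l2_bounded f (fine (l2_sqnorm f) - e).
  by move=> F; rewrite leNgt; apply/negP/h.
by rewrite lerBrDr gerDl leNgt e0.
Qed.

Notation totally := (@summability.totally X).
#[local] Existing Instance summability.totally_filter.

Lemma sqsum_cvg f : l2 f ->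
  ((sqsum f F)%:C : R[i]^o) @[F --> totally] --> ((fine (l2_sqnorm f))%:C : R[i]^o).
Proof.
move=> f2; apply/cvgrPdist_lt => e e0.
have [r er r0] := pos_complex_real e0.
have [F hF] := l2_approx f2 r0.
exists F => // G /= FG; rewrite -rmorphB /= ger0_norm; last first.
  by rewrite ler0c subr_ge0 sqsum_le_l2.
by rewrite er ltcR ltrBlDl -ltrBlDr (lt_le_trans hF) ?sqsum_mono.
Qed.

Lemma normc_sqr (z : R[i]) : normc z ^+ 2 = complex.Re z ^+ 2 + complex.Im z ^+ 2.
Proof. by case: z => a b /=; rewrite sqr_sqrtr // addr_ge0 ?sqr_ge0. Qed.

Lemma normc_sqrC (z : R[i]) : (normc z ^+ 2)%:C = z * z^*.
Proof. by rewrite -normCK rmorphXn. Qed.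

Lemma sqnormD_le (a : R[i]) f g x : normc (a * f x + g x) ^+ 2 <=
  2 * (normc a ^+ 2 * normc (f x) ^+ 2) + 2 * normc (g x) ^+ 2.
Proof.
rewrite -exprMn -ComplexField.Normc.normcM; move: (a * f x) (g x) => [p q] [r s].
rewrite !normc_sqr /= -subr_ge0.
have -> : 2 * (p ^+ 2 + q ^+ 2) + 2 * (r ^+ 2 + s ^+ 2) - ((p + r) ^+ 2 + (q + s) ^+ 2)
  = (p - r) ^+ 2 + (q - s) ^+ 2 by ring.
by rewrite addr_ge0 ?sqr_ge0.
Qed.

Lemma l2_linear (a : R[i]) f g : l2 f -> l2 g -> l2 (a *: f + g).
Proof.
move=> f2 g2.
suff [] : l2 (a *: f + g) /\ fine (l2_sqnorm (a *: f + g)) <=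
   2 * (normc a ^+ 2 * fine (l2_sqnorm f)) + 2 * fine (l2_sqnorm g) by [].
apply: l2_bounded => F; apply: (@le_trans _ _
   (2 * (normc a ^+ 2 * sqsum f F) + 2 * sqsum g F)).
  rewrite !mulr_sumr -big_split /=; apply: ler_sum => x _; exact: sqnormD_le.
rewrite lerD // ler_pM2l //; [apply: ler_wpM2l; rewrite ?sqr_ge0 //|]; exact: sqsum_le_l2.
Qed.

Lemma l2_0 : l2 (0 : X -> R[i]).
Proof.
suff [] : l2 (0 : X -> R[i]) /\ fine (l2_sqnorm (0 : X -> R[i])) <= 0 by [].
apply: l2_bounded => F; rewrite /sqsum big1 // => x _.
by rewrite ComplexField.Normc.normc0 expr0n.
Qed.

Definition inner_sum f g F : R[i] := \sum_(x <- F) f x * (g x)^*.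

(** Polarization reduces the convergence of the partial sums of an inner product
    to that of sums of squares, which are monotone. *)
Lemma inner_sum_polarization f g F : inner_sum f g F = 4^-1 *
  ((sqsum (1 *: g + f) F)%:C - (sqsum ((-1) *: g + f) F)%:C
   + 'i%C * ((sqsum ('i%C *: g + f) F)%:C - (sqsum ((- 'i%C) *: g + f) F)%:C)).
Proof.
rewrite -!rmorphB /= -!sumrB.
rewrite !rmorph_sum /= mulr_sumr -big_split /= mulr_sumr; apply: eq_bigr => x _.
have E (a : R[i]) : (a *: g + f) x = a * g x + f x by [].
rewrite !rmorphB /= !E !normc_sqrC.
have i2 : 'i%C * 'i%C = -1 :> R[i] by rewrite -expr2 sqr_i.
rewrite !(rmorphD, rmorphM, rmorphN, rmorph1) /= conj_imaginary.
move: ('i%C) i2 (f x) (g x) ((f x)^*) ((g x)^*) => i i2 p q p' q'.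
suff -> : p * q' = 4^-1 * (2 * (q * p') + 2 * (p * q')
    + (i * i) * (2 * (q * p') - 2 * (p * q'))) by field.
by rewrite i2; field.
Qed.

End PartialSums.

Section Inner.
Variables (R : realType) (X : choiceType).
Implicit Types (f g : X -> R[i]) (F : {fset X}).
Notation totally := (@summability.totally X).
#[local] Existing Instance summability.totally_filter.

Lemma inner_sum_is_cvg f g : l2 f -> l2 g ->
  cvg ((inner_sum f g F : R[i]^o) @[F --> totally]).
Proof.
move=> f2 g2.
have L (a : R[i]) : cvg (((sqsum (a *: g + f) F)%:C : R[i]^o) @[F --> totally]).
  by apply/cvg_ex; eexists; exact: (sqsum_cvg (l2_linear a g2 f2)).
pose N (a : R[i]) : {fset X} -> R[i]^o := fun F => (sqsum (a *: g + f) F)%:C.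
have -> : (fun F => inner_sum f g F : R[i]^o) = (4^-1 : R[i]) *:
    ((N 1 - N (-1)) + ('i%C : R[i]) *: (N 'i%C - N (- 'i%C))).
  by apply/funext => F; exact: inner_sum_polarization.
have {}L a : cvg (N a @ totally) by exact: L.
apply: is_cvgZr; apply: is_cvgD; first exact: is_cvgB.
by apply: is_cvgZr; exact: is_cvgB.
Qed.

(** The inner product is a limit along the directed set of finite subsets, so that
    its algebraic identities are inherited from finite sums. *)
Definition l2ip f g : R[i] := lim ((inner_sum f g F : R[i]^o) @[F --> totally]).

Lemma l2ip_cvg f g : l2 f -> l2 g ->
  (inner_sum f g F : R[i]^o) @[F --> totally] --> (l2ip f g : R[i]^o).
Proof. exact: inner_sum_is_cvg. Qed.

Lemma l2ip_unique f g (l : R[i]) :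
  (inner_sum f g F : R[i]^o) @[F --> totally] --> (l : R[i]^o) -> l2ip f g = l.
Proof. by move=> h; apply: (@cvg_lim R[i]^o) => //; exact: norm_hausdorff. Qed.

Lemma l2ip_linear (a : R[i]) f f' g : l2 f -> l2 f' -> l2 g ->
  l2ip (a *: f + f') g = a * l2ip f g + l2ip f' g.
Proof.
move=> f2 f2' g2; apply: l2ip_unique.
have -> : (fun F => inner_sum (a *: f + f') g F : R[i]^o) =
   a *: (inner_sum f g : _ -> R[i]^o) + (inner_sum f' g : _ -> R[i]^o).
  apply/funext => F; transitivity (a * inner_sum f g F + inner_sum f' g F); last by [].
  rewrite /inner_sum mulr_sumr -big_split; apply: eq_bigr => x _ /=.
  by rewrite mulrA -mulrDl.
by apply: cvgD; [apply: cvgZr|]; exact: l2ip_cvg.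
Qed.

Lemma l2ip_conj f g : l2 f -> l2 g -> l2ip g f = (l2ip f g)^*.
Proof.
move=> f2 g2; apply: l2ip_unique; apply/cvgrPdist_lt => e e0.
have /cvgrPdist_lt /(_ e e0) := l2ip_cvg f2 g2; apply: filterS => F.
rewrite -norm_conjC rmorphB /= => h; congr (`| _ - _| < _) : h.
by rewrite rmorph_sum; apply: eq_bigr => x _; rewrite rmorphM /= conjCK mulrC.
Qed.

Lemma l2ipff f : l2 f -> l2ip f f = (fine (l2_sqnorm f))%:C.
Proof.
move=> f2; apply: l2ip_unique.
have -> : (fun F => inner_sum f f F : R[i]^o) = (fun F => (sqsum f F)%:C : R[i]^o).
  apply/funext => F; rewrite rmorph_sum; apply: eq_bigr => x _.
  by rewrite -normc_sqrC.
exact: sqsum_cvg.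
Qed.

Lemma l2ip_disjoint f g : (forall x, f x * (g x)^* = 0) -> l2ip f g = 0.
Proof.
move=> h; apply: l2ip_unique.
have -> : (fun F => inner_sum f g F : R[i]^o) = fun _ => 0.
  by apply/funext => F; rewrite /inner_sum big1.
exact: cvg_cst.
Qed.

Lemma l2_sqnorm_eq0 f : l2 f -> fine (l2_sqnorm f) = 0 -> f = 0.
Proof.
move=> f2 f0; apply/funext => x; apply/eqP.
have := sqsum_le_l2 [fset x]%fset f2; rewrite f0 /sqsum big_seq_fset1.
move=> h; apply/eqP/ComplexField.Normc.eq0_normc/eqP.
by rewrite -sqrf_eq0 eq_le h sqr_ge0.
Qed.

Definition l2pred : {pred X -> R[i]} := fun f => `[< l2 f >].

Lemma l2_submod_closed : submod_closed l2pred.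
Proof.
split; first by apply/asboolP; exact: l2_0.
by move=> a f g /asboolP f2 /asboolP g2; apply/asboolP; exact: l2_linear.
Qed.

HB.instance Definition _ := GRing.isSubmodClosed.Build _ _ l2pred l2_submod_closed.

Record l2space := L2 { l2fun : X -> R[i]; l2funP : l2fun \in l2pred }.

HB.instance Definition _ := [isSub for l2fun].
HB.instance Definition _ := [Choice of l2space by <:].
HB.instance Definition _ := [SubChoice_isSubLmodule of l2space by <:].

Lemma l2fun_l2 (u : l2space) : l2 (l2fun u).
Proof. by case: u => f /= /asboolP. Qed.

Definition l2dot (u v : l2space) : R[i] := l2ip (l2fun u) (l2fun v).

Lemma l2dot_linear (a : R[i]) u v w : l2dot (a *: u + v) w = a * l2dot u w + l2dot v w.
Proof. by apply: l2ip_linear; exact: l2fun_l2. Qed.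

Lemma l2dot_conj u v : l2dot u v = (l2dot v u)^*.
Proof. by apply: l2ip_conj; exact: l2fun_l2. Qed.

Lemma l2dot_bilinear : bilinear_for *%R (Num.conj \; *%R) l2dot.
Proof.
split=> [w a u v|w a u v]; first exact: l2dot_linear.
by rewrite l2dot_conj l2dot_linear rmorphD rmorphM /= -!l2dot_conj.
Qed.
HB.instance Definition _ := bilinear_isBilinear.Build _ _ _ _ _ _ l2dot l2dot_bilinear.

Lemma l2dot_hermitian u v : l2dot u v = (-1) ^+ false * (l2dot v u)^*.
Proof. by rewrite mul1r; exact: l2dot_conj. Qed.
HB.instance Definition _ := isHermitianSesquilinear.Build _ _ _ _ l2dot l2dot_hermitian.

Lemma l2dot_gt0 u : u != 0 -> 0 < l2dot u u.
Proof.
move=> u0; rewrite lt_def /l2dot l2ipff ?ler0c; last exact: l2fun_l2.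
apply/andP; split; last by rewrite fine_ge0 // l2_sqnorm_ge0.
apply: contra u0 => /eqP [h]; apply/eqP/val_inj.
exact: l2_sqnorm_eq0 (l2fun_l2 u) h.
Qed.
HB.instance Definition _ := isDotProduct.Build _ _ l2dot l2dot_gt0.

Definition l2space_norm (u : l2space) : R[i] := sqrtC (l2dot u u).

Lemma l2space_normE u : l2space_norm u = (l2_norm (l2fun u))%:C.
Proof.
rewrite /l2space_norm /l2dot l2ipff /l2_norm; last exact: l2fun_l2.
set s := fine _; have s0 : 0 <= s by rewrite fine_ge0 // l2_sqnorm_ge0.
by rewrite -{1}(sqr_sqrtr s0) rmorphXn /= sqrCK // ler0c sqrtr_ge0.
Qed.

Lemma l2space_norm_triangle u v : l2space_norm (u + v) <= l2space_norm u + l2space_norm v.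
Proof. exact: dot_triangle. Qed.

Lemma l2space_normZ (a : R[i]) u : l2space_norm (a *: u) = `|a| * l2space_norm u.
Proof.
rewrite /l2space_norm (dnormZ l2dot) sqrtCM ?nnegrE ?exprn_ge0 ?dnorm_ge0 //.
by rewrite sqrCK.
Qed.

Lemma l2space_norm_eq0 u : l2space_norm u = 0 -> u = 0.
Proof. by move/eqP; rewrite sqrt_dnorm_eq0 => /eqP. Qed.

HB.instance Definition _ := Lmodule_isNormed.Build R[i] l2space
  l2space_norm_triangle l2space_normZ l2space_norm_eq0.

End Inner.

Section Complete.
Variables (R : realType) (X : choiceType).
Local Notation H := (l2space R X).
Implicit Types (u v : H) (F : {fset X}).

Lemma sqsum_l2space_le u F : (sqsum (l2fun u) F)%:C <= `|u| ^+ 2.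
Proof.
rewrite /Num.norm /= sqrtCK /l2dot l2ipff; last exact: l2fun_l2.
by rewrite lecR; apply: sqsum_le_l2; exact: l2fun_l2.
Qed.

Lemma l2space_norm_le u (r : R) : 0 <= r ->
  (forall F, sqsum (l2fun u) F <= r ^+ 2) -> `|u| <= r%:C.
Proof.
move=> r0 /l2_bounded [u2 h].
rewrite -(@ler_pXn2r _ 2) ?nnegrE ?ler0c // /Num.norm /= sqrtCK /l2dot l2ipff //.
by rewrite -rmorphXn lecR.
Qed.

Lemma sqsum_le_of_norm_lt u F (r : R) : 0 < r -> `|u| < r%:C -> sqsum (l2fun u) F <= r ^+ 2.
Proof.
move=> r0 ur; rewrite -lecR (le_trans (sqsum_l2space_le u F)) //.
by rewrite [leRHS]rmorphXn /= ler_pXn2r ?nnegrE ?ler0c ?(ltW r0) ?(ltW ur) //.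
Qed.

Lemma normc_ge0 (z : R[i]) : 0 <= normc z.
Proof. by case: z => a b; exact: sqrtr_ge0. Qed.

Lemma normc_coord_le u x (r : R) : 0 < r -> `|u| < r%:C -> normc (l2fun u x) <= r.
Proof.
move=> r0 /(sqsum_le_of_norm_lt [fset x]%fset r0); rewrite /sqsum big_seq_fset1.
by rewrite ler_pXn2r ?nnegrE ?(ltW r0) ?normc_ge0.
Qed.

Lemma ReB (z w : R[i]) : complex.Re (z - w) = complex.Re z - complex.Re w.
Proof. by case: z w => ? ? []. Qed.

Lemma ImB (z w : R[i]) : complex.Im (z - w) = complex.Im z - complex.Im w.
Proof. by case: z w => ? ? []. Qed.

Lemma Re_le_normc (z : R[i]) : `|complex.Re z| <= normc z.
Proof. by case: z => a b /=; rewrite -sqrtr_sqr ler_wsqrtr // lerDl sqr_ge0. Qed.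

Lemma Im_le_normc (z : R[i]) : `|complex.Im z| <= normc z.
Proof. by case: z => a b /=; rewrite -sqrtr_sqr ler_wsqrtr // lerDr sqr_ge0. Qed.

Lemma normc_sqr_le (z : R[i]) (r : R) : `|complex.Re z| <= r -> `|complex.Im z| <= r ->
  normc z ^+ 2 <= 2 * r ^+ 2.
Proof.
move=> h1 h2; rewrite normc_sqr mulr2n mulrDl mul1r lerD //.
  by rewrite -real_normK ?num_real // ler_pXn2r ?nnegrE // (le_trans _ h1).
by rewrite -real_normK ?num_real // ler_pXn2r ?nnegrE // (le_trans _ h2).
Qed.

Section Filter.
Variables (G : set_system H) (GG : ProperFilter G).
Hypothesis cauchyG : cauchy G.

(** The map h stands for the real or the imaginary part. *)
Lemma cauchy_coord (h : R[i] -> R) x :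
  (forall z z', h (z - z') = h z - h z') -> (forall z, `|h z| <= normc z) ->
  exists l : R, forall r, 0 < r -> G [set u | `|h (l2fun u x) - l| <= r].
Proof.
move=> hB hle.
have : cvg (h (l2fun u x) @[u --> G]).
  apply/cauchy_cvgP/cauchyP => e e0.
  have e0' : 0 < (e / 2)%:C :> R[i] by rewrite ltcR divr_gt0.
  have [u Gu] := (cauchyP _).1 cauchyG _ e0'.
  exists (h (l2fun u x)).
  suff : G [set v | ball (h (l2fun u x)) e (h (l2fun v x))] by [].
  apply: filterS Gu => v.
  rewrite -!ball_normE /= => uv; rewrite -hB (le_lt_trans (hle _)) //.
  have -> : l2fun u x - l2fun v x = l2fun (u - v) x by [].
  rewrite (le_lt_trans (normc_coord_le x _ uv)) ?divr_gt0 //.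
  by rewrite ltr_pdivrMr // ltr_pMr // ltr1n.
move=> /cvg_ex [l hl]; exists l => r r0.
have /cvgrPdist_le /(_ r r0) := hl.
by apply: filterS => u /=; rewrite distrC.
Qed.

Lemma filter_all_seq (P : X -> set H) (s : seq X) : (forall x, G (P x)) ->
  G [set u | forall x, x \in s -> P x u].
Proof.
move=> GP; elim: s => [|y s IH]; first by apply: filterS filterT.
apply: filterS2 (GP y) IH => u Py Ps x; rewrite inE => /orP [/eqP -> //|]; exact: Ps.
Qed.

(** The pointwise limit f of a Cauchy filter is its limit in norm.  On a finite
    set F, the distance of u to f is estimated through an auxiliary v that is
    close to u in norm and close to f at the points of F; the bound obtained
    does not depend on F. *)
Lemma l2space_cauchy_cvg : cvg G.
Proof.
have /choice [a Ha] x := cauchy_coord x ReB Re_le_normc.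
have /choice [b Hb] x := cauchy_coord x ImB Im_le_normc.
pose f x := Complex (a x) (b x).
have close (e : R) : 0 < e -> exists2 u0 : H, G (ball u0 e%:C) &
    forall u, ball u0 e%:C u -> forall F, sqsum (l2fun u - f) F <= (4 * e) ^+ 2.
  move=> e0; have e0' : 0 < e%:C :> R[i] by rewrite ltcR.
  have [u0 Gu0] := (cauchyP _).1 cauchyG _ e0'.
  exists u0 => // u u0u F.
  (* Small enough for #|F| * r ^+ 2 <= e ^+ 2. *)
  pose r := e / (#|` F|.+1)%:R.
  have r0 : 0 < r by rewrite divr_gt0.
  have GF := filter_all_seq F (fun x => @filterI _ G GG _ _ (Ha x r r0) (Hb x r r0)).
  have [v [u0v vF]] := filter_ex (filterI Gu0 GF).
  have uv : `|u - v| < (2 * e)%:C.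
    have -> : u - v = (u0 - v) - (u0 - u) by rewrite opprB [RHS]addrC addrA subrK.
    rewrite mulr2n mulrDl mul1r rmorphD; apply: le_lt_trans (ler_normB _ _) _.
    by apply: ltrD; [move: u0v|move: u0u]; rewrite -ball_normE.
  have h1 := sqsum_le_of_norm_lt F _ uv.
  have h2 : sqsum (l2fun v - f) F <= 2 * e ^+ 2.
    apply: (@le_trans _ _ (\sum_(x <- F) 2 * r ^+ 2)).
      rewrite /sqsum big_seq [leRHS]big_seq; apply: ler_sum => x /vF [h2 h3].
      have -> : (l2fun v - f) x = l2fun v x - Complex (a x) (b x) by [].
      by apply: normc_sqr_le; rewrite ?ReB ?ImB.
    rewrite big_const_seq count_predT iter_addr_0 -mulrnAr ler_pM2l //.
    rewrite -mulr_natr /r expr_div_n mulrAC ler_pdivrMr ?exprn_gt0 //.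
    rewrite ler_wpM2l ?exprn_ge0 ?(ltW e0) //.
    by rewrite -natrX ler_nat expnS expn1 (leq_trans (leqnSn _)) // leq_pmulr.
  have h3 : sqsum (l2fun u - f) F <= 2 * sqsum (l2fun (u - v)) F + 2 * sqsum (l2fun v - f) F.
    rewrite /sqsum !mulr_sumr -big_split; apply: ler_sum => x _ /=.
    have := sqnormD_le 1 (l2fun (u - v)) (l2fun v - f) x.
    rewrite ComplexField.Normc.normc1 expr1n !mul1r; congr (normc _ ^+ 2 <= _).
    have E1 : l2fun (u - v) x = l2fun u x - l2fun v x by [].
    by rewrite E1 !fctE addrA subrK.
  apply: le_trans h3 _; have := h1 (mulr_gt0 _ e0); rewrite ltr0n => /(_ isT) h4.
  have -> : (4 * e) ^+ 2 = 2 * ((2 * e) ^+ 2) + 2 * (4 * e ^+ 2) by ring.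
  rewrite lerD // ler_pM2l // (le_trans h2) // ler_wpM2r ?exprn_ge0 ?(ltW e0) //.
  by rewrite ler_nat.
have f2 : f \in @l2pred R X.
  have [u0 Gu0 Hu0] := close 1 ltr01.
  have [u u0u] := filter_ex Gu0.
  have [h _] := l2_bounded (Hu0 u u0u).
  have -> : f = l2fun u - (l2fun u - f) by rewrite opprB addrC subrK.
  by rewrite rpredB ?l2funP //; apply/asboolP.
apply/cvg_ex; exists (L2 f2); apply/cvgrPdist_le => e e0.
have [r er r0] := pos_complex_real e0.
have r4 : 0 < r / 4 by rewrite divr_gt0.
have [u0 Gu0 Hu0] := close _ r4; apply: filterS Gu0 => u /Hu0 h.
rewrite distrC er; apply: l2space_norm_le; first exact: ltW.
by move=> F; rewrite (le_trans (h F)) // mulrC divfK ?pnatr_eq0.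
Qed.
End Filter.
End Complete.

HB.instance Definition _ (R : realType) (X : choiceType) :=
  Uniform_isComplete.Build (l2space R X) (@l2space_cauchy_cvg R X).

Lemma l2dot_norm (R : realType) (X : choiceType) (u : l2space R X) :
  `|u| ^+ 2 = l2dot u u.
Proof. by rewrite /Num.norm /= sqrtCK. Qed.

Definition l2hilbert (R : realType) (X : choiceType) : hilbertSpace R :=
  @HilbertSpace R (l2space R X) (@l2dot R X) (@l2dot_norm R X).

(** * Positive definite kernels as operators on finitely supported functions *)

Section FiniteSupport.
Variables (R : realType) (X : choiceType).

Definition finsupp_pred : {pred X -> R[i]} :=
  fun f => `[< finite_set [set x | f x != 0] >].

Lemma finsupp_submod_closed : submod_closed finsupp_pred.
Proof.
split.
  apply/asboolP; suff -> : [set x : X | (0 : X -> R[i]) x != 0] = set0 by [].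
  by apply/seteqP; split => x //=; rewrite eqxx.
move=> a f g /asboolP f2 /asboolP g2; apply/asboolP.
apply: (@sub_finite_set _ _ ([set x | f x != 0] `|` [set x | g x != 0])).
  move=> x /= h; have [fx|] := eqVneq (f x) 0; last by left.
  by right; apply: contra h => /eqP gx; rewrite !fctE fx gx scaler0 addr0.
by rewrite finite_setU.
Qed.
HB.instance Definition _ :=
  GRing.isSubmodClosed.Build _ _ finsupp_pred finsupp_submod_closed.

Record fsvec := FsVec { fscoef : X -> R[i]; fscoefP : fscoef \in finsupp_pred }.

HB.instance Definition _ := [isSub for fscoef].
HB.instance Definition _ := [Choice of fsvec by <:].
HB.instance Definition _ := [SubChoice_isSubLmodule of fsvec by <:].

Implicit Types (u v : fsvec) (F : {fset X}).

Lemma fscoefD u v x : fscoef (u + v) x = fscoef u x + fscoef v x.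
Proof. by []. Qed.

Lemma fscoefB u v x : fscoef (u - v) x = fscoef u x - fscoef v x.
Proof. by []. Qed.

Lemma fscoefZ (a : R[i]) u x : fscoef (a *: u) x = a * fscoef u x.
Proof. by []. Qed.

Definition supp u : {fset X} := fset_set [set x | fscoef u x != 0].

Lemma in_supp u x : (x \in supp u) = (fscoef u x != 0).
Proof.
have /asboolP finu := fscoefP u.
by rewrite /supp in_fset_set //; apply/idP/idP => [/set_mem|h]; rewrite ?inE.
Qed.

(** Summing over the support of v alone makes linearity in u immediate; the
    choice of the finite set is irrelevant by [fdotE]. *)
Definition fdot u v : R[i] := \sum_(x <- supp v) fscoef u x * (fscoef v x)^*.

Lemma fdotE u v F : (forall x, fscoef u x * (fscoef v x)^* != 0 -> x \in F) ->
  fdot u v = \sum_(x <- F) fscoef u x * (fscoef v x)^*.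
Proof.
move=> uvF; pose w x := fscoef u x * (fscoef v x)^*.
have w0 x : x \notin (F `&` supp v)%fset -> w x = 0.
  rewrite in_fsetI negb_and => /orP [xF|xv].
    by apply/eqP; apply: contraNT xF; exact: uvF.
  by move: xv; rewrite in_supp negbK /w => /eqP ->; rewrite conjC0 mulr0.
by rewrite /fdot -(big_fset_incl _ (fsubsetIr F (supp v))) => [|x _ /w0 //];
  rewrite (big_fset_incl _ (fsubsetIl F (supp v))) // => x _ /w0.
Qed.

Lemma fdot_suppl u v F : (supp u `<=` F)%fset ->
  fdot u v = \sum_(x <- F) fscoef u x * (fscoef v x)^*.
Proof.
move=> /fsubsetP uF; apply: fdotE => x h; apply: uF; rewrite in_supp.
by apply: contra h => /eqP ->; rewrite mul0r.
Qed.

Lemma fdot_suppr u v F : (supp v `<=` F)%fset ->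
  fdot u v = \sum_(x <- F) fscoef u x * (fscoef v x)^*.
Proof.
move=> /fsubsetP uF; apply: fdotE => x h; apply: uF; rewrite in_supp.
by apply: contra h => /eqP ->; rewrite conjC0 mulr0.
Qed.

Lemma fdot_conj u v : fdot u v = (fdot v u)^*.
Proof.
rewrite (fdot_suppl _ (fsubset_refl (supp u))) rmorph_sum.
by apply: eq_bigr => x _; rewrite rmorphM /= conjCK mulrC.
Qed.

Lemma fdot_linear (a : R[i]) u v w : fdot (a *: u + v) w = a * fdot u w + fdot v w.
Proof.
rewrite /fdot mulr_sumr -big_split; apply: eq_bigr => x _ /=.
rewrite mulrA -mulrDl; congr (_ * _).
Qed.

Lemma fdot_bilinear : bilinear_for *%R (Num.conj \; *%R) fdot.
Proof.
split=> [w a u v|w a u v]; first exact: fdot_linear.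
by rewrite fdot_conj fdot_linear rmorphD rmorphM /= -!fdot_conj.
Qed.
HB.instance Definition _ := bilinear_isBilinear.Build _ _ _ _ _ _ fdot fdot_bilinear.

Lemma fdot_hermitian u v : fdot u v = (-1) ^+ false * (fdot v u)^*.
Proof. by rewrite mul1r; exact: fdot_conj. Qed.
HB.instance Definition _ := isHermitianSesquilinear.Build _ _ _ _ fdot fdot_hermitian.

Lemma fdot_gt0 u : u != 0 -> 0 < fdot u u.
Proof.
move=> u0; have [x ux] : exists x, fscoef u x != 0.
  apply: contrapT => /forallNP h; move/eqP: u0; apply; apply/val_inj/funext => x.
  by apply/eqP; have /negP := h x; rewrite negbK.
rewrite /fdot (big_fsetD1 x) /= ?in_supp // ltr_pwDl ?sumr_ge0 //.
- by rewrite -normCK exprn_gt0 ?normr_gt0.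
- by move=> y _; rewrite -normCK exprn_ge0.
Qed.
HB.instance Definition _ := isDotProduct.Build _ _ fdot fdot_gt0.

Lemma fsvec_delta_subproof (x : X) :
  (fun y => if y == x then 1 else 0 : R[i]) \in finsupp_pred.
Proof.
apply/asboolP; apply: (@sub_finite_set _ _ [set x]); last exact: finite_set1.
by move=> y /=; case: (y =P x) => // _; rewrite eqxx.
Qed.
Definition fdelta x := FsVec (fsvec_delta_subproof x).

Lemma supp_fdelta x : supp (fdelta x) = [fset x]%fset.
Proof.
apply/fsetP => y; rewrite in_supp in_fset1 /=.
by case: (y =P x) => // _; rewrite ?oner_eq0 ?eqxx.
Qed.

Lemma fdot_fdelta u x : fdot u (fdelta x) = fscoef u x.
Proof. by rewrite /fdot supp_fdelta big_seq_fset1 /= eqxx conjC1 mulr1. Qed.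

Section KernelOperator.
Variable k : X * X -> R[i].
Hypothesis rowfin : forall x, finite_set [set y | k (x, y) != 0].
Hypothesis colfin : forall y, finite_set [set x | k (x, y) != 0].

Definition kernel_row x : {fset X} := fset_set [set y | k (x, y) != 0].

Lemma in_kernel_row x y : (y \in kernel_row x) = (k (x, y) != 0).
Proof. by rewrite in_fset_set //; apply/idP/idP => [/set_mem|h]; rewrite ?inE. Qed.

Definition kernel_apply (f : X -> R[i]) x : R[i] := \sum_(y <- kernel_row x) k (x, y) * f y.

Lemma kernel_apply_neq0 f x : kernel_apply f x != 0 -> exists2 y, k (x, y) != 0 & f y != 0.
Proof.
move=> h; apply: contrapT => nh; move/eqP: h; apply.
rewrite /kernel_apply big_seq big1 // => y; rewrite in_kernel_row => kxy.
have [->|fy] := eqVneq (f y) 0; first by rewrite mulr0.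
by case: nh; exists y.
Qed.

Lemma kernel_apply_finsupp u : kernel_apply (fscoef u) \in finsupp_pred.
Proof.
have /asboolP finu := fscoefP u; apply/asboolP.
apply: (sub_finite_set _ (bigcup_finite finu (fun y _ => colfin y))).
by move=> x /kernel_apply_neq0 [y kxy uy]; exists y.
Qed.

Definition kernel_op u := FsVec (kernel_apply_finsupp u).

Lemma kernel_op_linear : linear kernel_op.
Proof.
move=> a u v; apply/val_inj/funext => x /=.
transitivity (a * kernel_apply (fscoef u) x + kernel_apply (fscoef v) x); last by [].
rewrite /kernel_apply mulr_sumr -big_split; apply: eq_bigr => y _ /=.
transitivity (k (x, y) * (a * fscoef u y + fscoef v y)); first by [].
by ring.
Qed.
HB.instance Definition _ := GRing.isLinear.Build _ _ _ _ kernel_op kernel_op_linear.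

Lemma fdot_kernel_op u v F : (supp u `<=` F)%fset -> (supp v `<=` F)%fset ->
  fdot (kernel_op u) v =
  \sum_(x <- F) \sum_(y <- F) (fscoef v x)^* * fscoef u y * k (x, y).
Proof.
move=> uF vF; rewrite (fdot_suppr _ vF); apply: eq_bigr => x _ /=.
rewrite /kernel_apply mulr_suml.
have w0 y : y \notin (F `&` kernel_row x)%fset -> k (x, y) * fscoef u y * (fscoef v x)^* = 0.
  rewrite in_fsetI negb_and => /orP [yF|].
    have /eqP -> : fscoef u y == 0.
      by move: yF; apply: contraNT; rewrite -in_supp; apply/fsubsetP.
    by rewrite mulr0 mul0r.
  by rewrite in_kernel_row negbK => /eqP ->; rewrite !mul0r.
rewrite -(big_fset_incl _ (fsubsetIr F (kernel_row x))) => [|y _ /w0 //].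
rewrite (big_fset_incl _ (fsubsetIl F (kernel_row x))) => [|y _ /w0 //].
by apply: eq_bigr => y _; ring.
Qed.

End KernelOperator.
End FiniteSupport.

Section PositiveDefinite.
Variables (R : realType) (X : choiceType) (k : X * X -> R[i]).
Hypothesis kpd : positive_definite_kernel k.

(** The points of a positive definite kernel may be listed by any sequence, here
    the support of a vector, instead of a tuple. *)
Lemma pd_seq (s : seq X) (f : X -> R[i]) :
  0 <= \sum_(x <- s) \sum_(y <- s) (f x)^* * f y * k (x, y).
Proof.
have := kpd (tnth (in_tuple s)) (fun i => f (tnth (in_tuple s) i)).
rewrite (big_tnth _ _ s); under [X in _ -> 0 <= X]eq_bigr do rewrite (big_tnth _ _ s).
by [].
Qed.

Lemma pd_pair x y (a b : R[i]) :
  0 <= a^* * a * k (x, x) + a^* * b * k (x, y)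
       + (b^* * a * k (y, x) + b^* * b * k (y, y)).
Proof.
have := kpd (fun i : 'I_2 => if i == 0 then x else y)
            (fun i : 'I_2 => if i == 0 then a else b).
by rewrite !big_ord_recl !big_ord0 /= !addr0.
Qed.

Lemma pd_diag x : 0 <= k (x, x).
Proof. by have := pd_pair x x 1 0; rewrite conjC0 conjC1 !(mul0r, mulr0, mul1r, addr0). Qed.

(** Positivity on the vectors (1, 1) and (1, i) makes k (x, y) + k (y, x) and
    i (k (x, y) - k (y, x)) real. *)
Lemma pd_hermitian x y : k (y, x) = (k (x, y))^*.
Proof.
have h1 := pd_pair x y 1 1; have h2 := pd_pair x y 1 'i%C.
have kx := pd_diag x; have ky := pd_diag y.
move: h1 h2 kx ky; rewrite conj_imaginary !conjC1.
case: (k (x, x)) (k (y, y)) (k (x, y)) (k (y, x)) => [a a'] [b b'] [p q] [r s].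
rewrite !lecE /= => /andP[/eqP h1 _] /andP[/eqP h2 _] /andP[/eqP h3 _] /andP[/eqP h4 _].
apply/eqP; rewrite eq_complex /=; apply/andP; split; apply/eqP; lra.
Qed.

Lemma pd_normsq_le x y : `|k (x, y)| ^+ 2 <= k (x, x) * k (y, y).
Proof.
apply: discriminant_le; rewrite ?pd_diag // => s.
have := pd_pair x y (s^*) 1; rewrite (pd_hermitian x y) conjC1 conjCK !mul1r mulr1.
by rewrite rmorphM /= normCK -!addrA.
Qed.

Lemma pd_norm_le (B : R[i]) x y : (forall z, k (z, z) <= B) -> `|k (x, y)| <= B.
Proof.
move=> kB; have B0 : 0 <= B by apply: le_trans (kB x); exact: pd_diag.
rewrite -(@ler_pXn2r _ 2) ?nnegrE // (le_trans (pd_normsq_le x y)) // expr2.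
by rewrite ler_pM ?pd_diag.
Qed.

Section Bounded.
Variables (B : R[i]) (N : nat).
Hypothesis kB : forall x y, `|k (x, y)| <= B.
Hypothesis rowN : forall (F : {fset X}) x, (\sum_(y <- F) (k (x, y) != 0%R) <= N)%N.

(** Schur test: the row sums of |k| are at most B * N, and the inequality
    |a b| <= (|a|^2 + |b|^2) / 2 together with the symmetry of the support of k
    turns this into an operator bound. *)
Lemma pd_schur (F : {fset X}) (f : X -> R[i]) :
  \sum_(x <- F) \sum_(y <- F) (f x)^* * f y * k (x, y) <=
  (B * N%:R) * \sum_(x <- F) f x * (f x)^*.
Proof.
have [F0|[x0 _]] := fset_0Vmem F; first by rewrite F0 !big_seq_fset0 mulr0.
have B0 : 0 <= B by apply: le_trans (kB x0 x0).
apply: le_trans (real_ler_norm (ger0_real (pd_seq _ _))) _.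
pose c x y : R[i] := (k (x, y) != 0)%:R.
have cC x y : c x y = c y x by rewrite /c (pd_hermitian x y) conjC_eq0.
apply: (@le_trans _ _ (\sum_(x <- F) \sum_(y <- F)
    (B / 2 * (`|f x| ^+ 2 * c x y) + B / 2 * (`|f y| ^+ 2 * c x y)))).
  apply: le_trans (ler_norm_sum _ _ _) _; apply: ler_sum => x _.
  apply: le_trans (ler_norm_sum _ _ _) _; apply: ler_sum => y _.
  rewrite /c; have [->|k0] := eqVneq (k (x, y)) 0; first by rewrite !(mulr0, normr0, addr0).
  rewrite !mulr1 !normrM norm_conjC -mulrDr.
  apply: (@le_trans _ _ (B * (`|f x| * `|f y|))); first by rewrite mulrC ler_wpM2r ?mulr_ge0.
  rewrite -mulrA; apply: ler_wpM2l => //; rewrite ler_pdivlMl // -subr_ge0.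
  have -> : `|f x| ^+ 2 + `|f y| ^+ 2 - 2 * (`|f x| * `|f y|) = (`|f x| - `|f y|) ^+ 2 by ring.
  by rewrite -realEsqr realB ?normr_real.
have S x : \sum_(y <- F) c x y <= N%:R by rewrite -natr_sum ler_nat; exact: rowN.
under eq_bigr do rewrite big_split /=.
rewrite big_split /= [X in _ + X]exchange_big /=.
have half : \sum_(x <- F) \sum_(y <- F) B / 2 * (`|f x| ^+ 2 * c x y) <=
    B / 2 * N%:R * \sum_(x <- F) f x * (f x)^*.
  rewrite mulr_sumr; apply: ler_sum => x _.
  rewrite -mulr_sumr -mulr_sumr -normCK -[leRHS]mulrA.
  apply: ler_wpM2l; first by rewrite divr_ge0.
  by rewrite mulrC ler_wpM2r ?exprn_ge0.
apply: (@le_trans _ _ (B / 2 * N%:R * (\sum_(x <- F) f x * (f x)^*)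
  + B / 2 * N%:R * (\sum_(x <- F) f x * (f x)^*))).
  apply: lerD => //; apply: le_trans half; apply: ler_sum => x _; apply: ler_sum => y _.
  by rewrite cC.
by rewrite -mulrDl -mulrDl -splitr.
Qed.

Variable M : R[i].
Hypothesis M_gt0 : 0 < M.
Hypothesis M_ge : B * N%:R <= M.
Hypothesis rowfin : forall x, finite_set [set y | k (x, y) != 0].
Hypothesis colfin : forall y, finite_set [set x | k (x, y) != 0].

(** This is 1 - K / M for the operator K of the kernel k, and M is an upper
    bound of K: an operator between 0 and 1 to which the square root iteration
    applies. *)
Definition kernel_complement (u : fsvec R X) : fsvec R X := u - M^-1 *: kernel_op rowfin colfin u.

Lemma kernel_complement_linear : linear kernel_complement.
Proof.
move=> a u v; rewrite /kernel_complement [kernel_op _ _ _]linearP.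
rewrite scalerDr scalerBr opprD addrACA.
by congr (_ - _ + _); rewrite !scalerA mulrC.
Qed.
HB.instance Definition _ :=
  GRing.isLinear.Build _ _ _ _ kernel_complement kernel_complement_linear.

Lemma kernel_op_adj u v : fdot (kernel_op rowfin colfin u) v = fdot u (kernel_op rowfin colfin v).
Proof.
pose F := (supp u `|` supp v)%fset.
rewrite [RHS]fdot_conj.
rewrite (@fdot_kernel_op _ _ _ _ _ u v F) ?fsubsetUl ?fsubsetUr //.
rewrite (@fdot_kernel_op _ _ _ _ _ v u F) ?fsubsetUl ?fsubsetUr //.
rewrite exchange_big rmorph_sum; apply: eq_bigr => x _ /=.
rewrite rmorph_sum; apply: eq_bigr => y _ /=.
by rewrite (pd_hermitian y x) !rmorphM /= !conjCK; ring.
Qed.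

Lemma kernel_op_ge0 u : 0 <= fdot (kernel_op rowfin colfin u) u.
Proof. by rewrite (@fdot_kernel_op _ _ _ _ _ u u (supp u)) //; exact: pd_seq. Qed.

Lemma kernel_op_le u : fdot (kernel_op rowfin colfin u) u <= M * fdot u u.
Proof.
rewrite (@fdot_kernel_op _ _ _ _ _ u u (supp u)) //.
apply: le_trans (pd_schur _ _) _; rewrite ler_wpM2r //.
by apply: sumr_ge0 => x _; rewrite -normCK exprn_ge0.
Qed.

Lemma kernel_complement_dot u v :
  fdot (kernel_complement u) v = fdot u v - M^-1 * fdot (kernel_op rowfin colfin u) v.
Proof. by rewrite /kernel_complement linearBl linearZl_LR. Qed.

Lemma kernel_complement_adj u v : fdot (kernel_complement u) v = fdot u (kernel_complement v).
Proof.
have /CrealP MV : M^-1 \is Num.real by rewrite realV gtr0_real.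
by rewrite [RHS]fdot_conj !kernel_complement_dot rmorphB rmorphM /= -!fdot_conj MV kernel_op_adj.
Qed.

Lemma kernel_complement_ge0 u : 0 <= fdot (kernel_complement u) u.
Proof. by rewrite kernel_complement_dot subr_ge0 ler_pdivrMl // kernel_op_le. Qed.

Lemma kernel_complement_le1 u : fdot (kernel_complement u) u <= fdot u u.
Proof.
by rewrite kernel_complement_dot gerBl mulr_ge0 ?invr_ge0 ?(ltW M_gt0) // kernel_op_ge0.
Qed.

(** The image of the point mass at x under an approximation of the square root
    of K / M, with Gram matrix close to k / M. *)
Definition sqrt_vector n x : fsvec R X :=
  fdelta R x - visser kernel_complement n (fdelta R x).

Lemma sqrt_vector_dot n x y :
  `|fdot (sqrt_vector n x) (sqrt_vector n y) - k (y, x) / M| <= 2 / n.+1%:R.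
Proof.
have : `|fdot (sqrt_vector n x) (sqrt_vector n y)
          - fdot (fdelta R x - kernel_complement (fdelta R x)) (fdelta R y)| <=
    2 / n.+1%:R * (sqrtC (fdot (fdelta R x) (fdelta R x))
                   * sqrtC (fdot (fdelta R y) (fdelta R y))).
  exact: (approximate_sqrt (form := @fdot R X) kernel_complement_adj
            kernel_complement_ge0 kernel_complement_le1).
have -> : fdelta R x - kernel_complement (fdelta R x) =
    M^-1 *: kernel_op rowfin colfin (fdelta R x).
  by rewrite /kernel_complement opprB addrC subrK.
rewrite linearZl_LR /= !fdot_fdelta /= !eqxx sqrtC1 !mulr1 /kernel_apply.
have -> : \sum_(z <- kernel_row k y) k (y, z) * (if z == x then 1 else 0) = k (y, x).
  have [k0|k0] := eqVneq (k (y, x)) 0.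
    rewrite big1 // => z _; case: eqP => [->|]; by rewrite ?k0 ?mul0r ?mulr0.
  rewrite (big_fsetD1 x) /= ?in_kernel_row // eqxx mulr1 big1_fset ?addr0 // => z.
  by rewrite !inE => /andP[/negbTE -> _] _; rewrite mulr0.
by rewrite mulrC.
Qed.

Section Propagation.
Variable C : set (set (X * X)).
Hypothesis hC : coarse_structure C.
Hypothesis kC : C [set xy | k xy != 0].

(** One step of the iteration composes the propagation relation with itself and
    adds the support of k, hence the relation stays controlled. *)
Lemma visser_propagation n : exists2 E, C E & forall u z,
  fscoef (visser kernel_complement n u) z != 0 -> exists2 y, E (z, y) & fscoef u y != 0.
Proof.
elim: n => [|n [E CE hE]].
  by exists diagonal => [|u z /=]; [exact: coarse_diagonal hC|rewrite eqxx].
exists ((diagonal `|` [set xy | k xy != 0]) `|` (E \; E)%relation).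
  apply: (coarse_union hC); last by apply: (coarse_compose hC).
  by apply: (coarse_union hC) => //; exact: coarse_diagonal hC.
move=> u z; pose q := visser kernel_complement n (visser kernel_complement n u).
have [q0|q0 _] := eqVneq (fscoef q z) 0; last first.
  have [y Ezy /hE [x Eyx ux]] := hE _ _ q0.
  by exists x => //; right; exists y.
have [d0|d0 _] := eqVneq (fscoef (kernel_complement u) z) 0.
  rewrite [visser _ _ _]/(2^-1 *: (kernel_complement u + q)).
  by rewrite fscoefZ fscoefD q0 d0 addr0 mulr0 eqxx.
have [u0|u0] := eqVneq (fscoef u z) 0; last by exists z => //; left; left.
have K0 : kernel_apply k (fscoef u) z != 0.
  apply: contra d0 => /eqP K0.
  by rewrite /kernel_complement fscoefB fscoefZ u0 [fscoef _ z]K0 mulr0 subr0.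
by have [y kzy uy] := kernel_apply_neq0 rowfin K0; exists y => //; left; right.
Qed.

Lemma sqrt_vector_propagation n : exists2 E, C E & forall x z,
  fscoef (sqrt_vector n x) z != 0 -> E (x, z).
Proof.
have [E CE hE] := visser_propagation n.
exists (diagonal `|` (E^-1)%relation).
  by apply: (coarse_union hC); [exact: coarse_diagonal hC|by apply: (coarse_inverse hC)].
move=> x z; set q := visser kernel_complement n (fdelta R x).
have [q0|q0 _] := eqVneq (fscoef q z) 0; last first.
  have [y Ezy] := hE _ _ q0; rewrite -in_supp supp_fdelta in_fset1 => /eqP yx.
  by right; rewrite /= -yx.
by rewrite fscoefB q0 subr0 -in_supp supp_fdelta in_fset1 => /eqP ->; left.
Qed.
End Propagation.
End Bounded.
End PositiveDefinite.

(** * From kernels to almost invariant vectors *)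

Lemma uniformly_locally_finite_card_le (X : choiceType) (C : set (set (X * X)))
    (T : set (X * X)) :
  uniformly_locally_finite C -> C T -> exists N : nat, forall y,
  finite_set [set x | T (x, y)] /\
  forall (F : {fset X}), (forall x, x \in F -> T (x, y)) -> (#|` F| <= N)%N.
Proof.
move=> hX /hX [N hN]; exists N => y.
have E : ysection T y = [set x | T (x, y)].
  by apply/seteqP; split => x; rewrite /ysection /= inE.
have fin : finite_set [set x | T (x, y)].
  by rewrite -E; apply/finite_set_leP; exists N.
split=> // F FT; apply: leq_trans (geq_card_fset_set (hN y)).
apply: fsubset_leq_card; apply/fsubsetP => x /FT Txy.
by rewrite E in_fset_set // inE.
Qed.

(** Normalization is dropped: it suffices that the vectors are bounded below and
    vary little relatively to their norms.  Squared norms avoid square roots. *)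
Definition almost_invariant_vectors (R : realType) (X : choiceType)
    (C : set (set (X * X))) : Prop :=
  forall (kappa : R) T, 0 < kappa -> C T ->
  exists (b : X -> fsvec R X) (s0 : R) (E : set (X * X)),
  [/\ C E, 0 < s0, forall x z, fscoef (b x) z != 0 -> E (x, z),
      forall x, s0%:C <= fdot (b x) (b x) &
      forall x y, T (x, y) -> fdot (b x - b y) (b x - b y) <=
        kappa%:C * (fdot (b x) (b x) + fdot (b y) (b y))].

Section AlmostInvariant.
Variables (R : realType) (X : choiceType) (C : set (set (X * X))).
Hypotheses (hC : coarse_structure C) (hX : uniformly_locally_finite C).

(** Almost invariant vectors are the columns b x of an approximate square root
    of the kernel: M <b x, b y> is within e of k (y, x), hence within 2 e of 1
    for related or equal points, which bounds M ||b x - b y||^2 by 8 e. *)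
Lemma almost_invariant_vectors_of_kernels :
  (forall (e : R) (T : set (X * X)), 0 < e -> C T ->
     exists k : X * X -> R[i],
       [/\ positive_definite_kernel k,
           forall x y, T (x, y) -> `|1 - k (x, y)| < e%:C &
           C [set xy | k xy != 0]]) ->
  almost_invariant_vectors R C.
Proof.
move=> H4 kappa T kappa0 CT.
(* With M the bound of the kernel operator, the four errors of size 2 e in
   M ||b x - b y||^2 must not exceed kappa, where M ||b x||^2 >= 1 / 2. *)
have [e [e0 e4 e8]] : exists e : R, [/\ 0 < e, 4 * e <= 1 & 8 * e <= kappa].
  exists (Num.min (1 / 4) (kappa / 8)); split.
  - by rewrite lt_min !divr_gt0.
  - by rewrite mulrC -ler_pdivlMr // ge_min lexx.
  - by rewrite mulrC -ler_pdivlMr // ge_min lexx orbT.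
have CT' : C (T `|` diagonal) by apply: (coarse_union hC) => //; exact: coarse_diagonal hC.
have [k [kpd kT kC]] := H4 e _ e0 CT'.
have kherm := pd_hermitian kpd.
have kdiag x : `|1 - k (x, x)| < e%:C by apply: kT; right.
have k2 x : k (x, x) <= 2%:R.
  have -> : k (x, x) = 1 - (1 - k (x, x)) by rewrite opprB addrC subrK.
  apply: le_trans (real_ler_norm _) _.
    by rewrite opprB addrC subrK ger0_real ?(pd_diag kpd).
  apply: le_trans (ler_normB _ _) _; rewrite normr1 -[leRHS]/(1 + 1) lerD2l.
  by apply: le_trans (ltW (kdiag x)) _; rewrite -[1]/(1%:C) lecR; lra.
have [N hN] := uniformly_locally_finite_card_le hX (coarse_inverse hC kC).
have [N' hN'] := uniformly_locally_finite_card_le hX kC.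
have rowN (F : {fset X}) x : (\sum_(y <- F) (k (x, y) != 0%R) <= N)%N.
  rewrite -big_mkcond /= big_fset_condE /= -card_fset_sum1.
  by apply: (hN x).2 => y; rewrite !inE => /andP[_].
have rowfin x : finite_set [set y | k (x, y) != 0] by exact: (hN x).1.
have colfin y : finite_set [set x | k (x, y) != 0] by exact: (hN' y).1.
have [M [M0 Mge]] : exists M : R, 0 < M /\ 2%:R * N%:R <= M%:C.
  exists ((2 * N)%:R + 1); split; first by rewrite ltr_pwDr.
  by rewrite -natrM -(rmorph_nat (real_complex R)) lecR lerDl.
have M0c : 0 < M%:C by rewrite ltcR.
have kB x y : `|k (x, y)| <= 2%:R by exact: pd_norm_le.
have [n hn] : exists n : nat, 2 / n.+1%:R <= e / M.
  exists (Num.trunc (2 * M / e)).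
  rewrite ler_pdivrMr // mulrAC ler_pdivlMr //.
  by rewrite [leRHS]mulrC -ler_pdivrMr // ltW // truncnS_gt.
pose b := sqrt_vector M%:C rowfin colfin n.
have [E CE hE] := sqrt_vector_propagation M%:C rowfin colfin hC kC n.
have gk x y : `|1 - k (y, x)| < e%:C -> `|M%:C * fdot (b x) (b y) - 1| <= (2 * e)%:C.
  move=> kyx; have := sqrt_vector_dot kpd kB rowN M0c Mge rowfin colfin n x y.
  rewrite -/b => h.
  have {}h : `|fdot (b x) (b y) - k (y, x) / M%:C| <= (e / M)%:C.
    apply: le_trans h _; rewrite -lecR in hn; apply: le_trans hn.
    by rewrite rmorphM fmorphV !rmorph_nat.
  have -> : M%:C * fdot (b x) (b y) - 1 =
      M%:C * (fdot (b x) (b y) - k (y, x) / M%:C) - (1 - k (y, x)).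
    by rewrite mulrBr mulrCA mulfV ?mulr1 ?gt_eqF // opprB addrA subrK.
  apply: le_trans (ler_normB _ _) _; 
  have -> : (2 * e)%:C = e%:C + e%:C :> R[i] by rewrite mulr2n mulrDl mul1r rmorphD.
  apply: lerD; last exact: ltW.
  rewrite normrM gtr0_norm // mulrC -ler_pdivlMr //.
  by apply: le_trans h _; rewrite rmorphM fmorphV.
have gxx x : (2^-1)%:C <= M%:C * fdot (b x) (b x).
  have h := gk x x (kdiag x); rewrite -subr_ge0.
  have r : M%:C * fdot (b x) (b x) \is Num.real.
    by rewrite realM // ger0_real ?(ltW M0c) // dnorm_ge0.
  move: h; rewrite distrC real_ler_norml ?realB ?real1 // => /andP[_].
  rewrite lerBlDl -lerBlDr => h; rewrite subr_ge0; apply: le_trans h.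
  rewrite -[X in X - _]/(1%:C) -rmorphB lecR; lra.
exists b, (2 * M)^-1, E; split=> //.
- by rewrite invr_gt0 mulr_gt0.
- move=> x; rewrite invfM rmorphM [X in _ * X]fmorphV /= mulrC ler_pdivrMl //.
- move=> x y Txy.
  have kxy : `|1 - k (x, y)| < e%:C by apply: kT; left.
  have kyx : `|1 - k (y, x)| < e%:C by rewrite kherm -norm_conjC rmorphB /= conjC1 conjCK.
  rewrite -(ler_pM2l M0c) mulrCA.
  apply: (@le_trans _ _ (8 * e)%:C); last first.
    apply: (@le_trans _ _ kappa%:C); first by rewrite lecR.
    rewrite -[leLHS]mulr1 ler_pM2l ?ltcR // mulrDr.
    apply: le_trans (lerD (gxx x) (gxx y)).
    by rewrite -rmorphD -[leLHS]/(1%:C) lecR; lra.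
  have hxx := gk x x (kdiag x); have hyy := gk y y (kdiag y).
  have hxy := gk x y kyx; have hyx := gk y x kxy.
  have E0 : 0 <= M%:C * fdot (b x - b y) (b x - b y).
    by rewrite mulr_ge0 ?(ltW M0c) // dnorm_ge0.
  rewrite -[leLHS](ger0_norm E0).
  have -> : M%:C * fdot (b x - b y) (b x - b y) =
     (M%:C * fdot (b x) (b x) - 1) + (M%:C * fdot (b y) (b y) - 1)
     - ((M%:C * fdot (b x) (b y) - 1) + (M%:C * fdot (b y) (b x) - 1)).
    by rewrite linearBl !linearBr /=; ring.
  apply: le_trans (ler_normB _ _) _.
  have -> : (8 * e)%:C = ((2 * e)%:C + (2 * e)%:C) + ((2 * e)%:C + (2 * e)%:C) :> R[i].
    by rewrite -!rmorphD; congr (_%:C); ring.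
  by apply: lerD; apply: le_trans (ler_normD _ _) _; apply: lerD.
Qed.
End AlmostInvariant.

(** * From almost invariant vectors to property A *)

Section Counting.
Variable T : choiceType.

Lemma card_symdiff (A B : set T) : finite_set A -> finite_set B ->
  (#|` fset_set (A `+` B)| + 2 * #|` fset_set (A `&` B)| =
   #|` fset_set A| + #|` fset_set B|)%N.
Proof.
move=> fA fB; rewrite setY_def fset_setU ?fset_setD ?fset_setI //; try exact: finite_setD.
set a := fset_set A; set b := fset_set B.
have := cardfsU (a `\` b)%fset (b `\` a)%fset.
have -> : ((a `\` b) `&` (b `\` a) = fset0)%fset.
  by apply/fsetP => x; rewrite !inE; case: (x \in a); case: (x \in b).
rewrite cardfs0 subn0 => ->.
rewrite -(cardfsID b a) -[#|` b|](cardfsID a b) [(b `&` a)%fset]fsetIC.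
lia.
Qed.

End Counting.

Section Subgraph.
Variable X : choiceType.
Implicit Types (a : X -> nat) (F : {fset X}).

(** Turns a finitely supported function with natural values into a finite set
    whose cardinal is the sum of its values. *)
Definition subgraph a : set (X * nat) := [set zn | (0 < zn.2 <= a zn.1)%N].

Lemma subgraph_fset a F : (forall z, (0 < a z)%N -> z \in F) ->
  subgraph a = [set` [fset zn | zn in [seq (z, i) | z <- F, i <- iota 1 (a z)]]%fset].
Proof.
move=> aF; apply/seteqP; split => [[z i] /= /andP[i0 ia]|[z i] /=].
  rewrite !inE; apply/allpairsPdep; exists z, i; split=> //.
    by apply: aF; exact: leq_trans ia.
  by rewrite mem_iota add1n ltnS i0.
rewrite !inE => /allpairsPdep [y [j [_ jy [-> ->]]]].
by move: jy; rewrite mem_iota add1n ltnS.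
Qed.

Lemma finite_subgraph a F : (forall z, (0 < a z)%N -> z \in F) -> finite_set (subgraph a).
Proof. by move=> /subgraph_fset ->; exact: finite_fset. Qed.

Lemma card_subgraph a F : (forall z, (0 < a z)%N -> z \in F) ->
  #|` fset_set (subgraph a)| = (\sum_(z <- F) a z)%N.
Proof.
move=> aF; rewrite (subgraph_fset aF) set_fsetK card_fseq undup_id; last first.
  apply: allpairs_uniq_dep; first exact: fset_uniq.
    by move=> z _; exact: iota_uniq.
  by move=> [z i] [y j] _ _ /= [-> ->].
rewrite size_allpairs_dep sumnE big_map; apply: eq_bigr => z _.
by rewrite size_iota.
Qed.

Lemma subgraphI a a' :
  subgraph a `&` subgraph a' = subgraph (fun z => minn (a z) (a' z)).
Proof.
apply/seteqP; split => [[z i]|[z i]] /=; rewrite /subgraph /= leq_min.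
  by move=> [/andP[-> ->] /andP[_ ->]].
by move=> /and3P[-> -> ->].
Qed.

(** Since the intersection of two subgraphs is the subgraph of the minimum, the
    cardinals occurring in property A become finite sums. *)
Lemma subgraph_symdiff_lt (R : realType) (e : R) a a' F :
  (forall z, (0 < a z)%N -> z \in F) -> (forall z, (0 < a' z)%N -> z \in F) ->
  (\sum_(z <- F) (a z)%:R + \sum_(z <- F) (a' z)%:R <
    (2 + e) * \sum_(z <- F) (minn (a z) (a' z))%:R) ->
  (#|` fset_set (subgraph a `+` subgraph a')|)%:R
    < e * (#|` fset_set (subgraph a `&` subgraph a')|)%:R.
Proof.
move=> aF aF'; rewrite -!natr_sum -(card_subgraph aF) -(card_subgraph aF').
rewrite -(@card_subgraph (fun z => minn (a z) (a' z))) -?subgraphI; last first.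
  by move=> z; rewrite leq_min => /andP[/aF].
rewrite -natrD -card_symdiff; [|exact: finite_subgraph aF|exact: finite_subgraph aF'].
by rewrite natrD natrM [X in _ < X]mulrDl [X in X < _]addrC ltrD2l.
Qed.
End Subgraph.

Section Discretise.
Variables (R : realType).

(** With al <= be, the difference be^2 - al^2 is at most om (al + be), which the
    inequality of arithmetic and geometric means with weight c splits; the
    weight is chosen large so that the second part is a small fraction of
    al^2 + be^2. *)
Lemma min_sqr_ge (al be om c : R) : 0 <= al -> 0 <= be -> 0 <= om -> 0 < c ->
  `|al - be| <= om ->
  (al ^+ 2 + be ^+ 2) - (c / 2 * om ^+ 2 + (al ^+ 2 + be ^+ 2) / c) <=
  2 * Num.min (al ^+ 2) (be ^+ 2).
Proof.
move=> al0 be0 om0 c0.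
wlog ab : al be al0 be0 / al <= be.
  move=> W; have [ab|/ltW ba] := leP al be; first exact: W.
  by rewrite distrC => h; rewrite minC (addrC (al ^+ 2)); exact: W.
rewrite distrC ger0_norm ?subr_ge0 // => h.
have -> : Num.min (al ^+ 2) (be ^+ 2) = al ^+ 2.
  by apply/min_idPl; rewrite ler_pXn2r ?nnegrE.
rewrite lerBlDl -lerBlDr.
apply: (@le_trans _ _ (om * (al + be))).
  have -> : al ^+ 2 + be ^+ 2 - 2 * al ^+ 2 = (be - al) * (al + be) by ring.
  by rewrite ler_wpM2r ?addr_ge0.
rewrite -subr_ge0.
have -> : c / 2 * om ^+ 2 + (al ^+ 2 + be ^+ 2) / c - om * (al + be) =
  ((c * om - (al + be)) ^+ 2 + (al - be) ^+ 2) / (2 * c).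
  by field; rewrite gt_eqF.
by rewrite divr_ge0 ?addr_ge0 ?sqr_ge0 ?mulr_ge0 // ltW.
Qed.
End Discretise.

Lemma normc_dist_le (R : realType) (z w : R[i]) : `|normc z - normc w| <= normc (z - w).
Proof.
have h (a b : R[i]) : normc a - normc b <= normc (a - b).
  by have := lerB_dist a b; rewrite -rmorphB lecR.
rewrite ler_norml lerNl opprB h andbT.
have -> : z - w = - (w - z) by rewrite opprB.
by case: (w - z) (h w z) => p q; rewrite /= !sqrrN.
Qed.

Section FromVectors.
Variables (R : realType) (X : choiceType) (C : set (set (X * X))).
Hypotheses (hC : coarse_structure C) (hX : uniformly_locally_finite C).

Lemma fdot_sqsum (u : fsvec R X) (F : {fset X}) : (supp u `<=` F)%fset ->
  fdot u u = (sqsum (fscoef u) F)%:C.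
Proof.
move=> uF; rewrite (fdot_suppl _ uF) rmorph_sum; apply: eq_bigr => z _.
by rewrite -normc_sqrC.
Qed.

(** The set A_x consists of the points below the graph of a rounding of
    Nn |b x|^2, with one extra unit at x.  The rounding costs at most 1 at each
    of the boundedly many points of the supports, which is negligible for large
    Nn, while [min_sqr_ge] shows that |b x|^2 and |b y|^2 mostly overlap. *)
Lemma property_A_of_vectors : almost_invariant_vectors R C -> property_A R C.
Proof.
move=> H e T e0 CT.
(* The weight for which (1 + e / 2) (1 - 2 / c) = 1 + e / 4. *)
pose c : R := (8 + 4 * e) / e.
have c0 : 0 < c by rewrite divr_gt0 // addr_gt0 // mulr_gt0.
have kappa0 : 0 < 2 / c ^+ 2 by rewrite divr_gt0 // exprn_gt0.
have [b [s0 [E [CE s00 bE bs bT]]]] := H _ T kappa0 CT.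
have [L hL] := uniformly_locally_finite_card_le hX (coarse_inverse hC CE).
have suppL x : (#|` supp (b x)| <= L)%N.
  by apply: (hL x).2 => z; rewrite in_supp => /bE.
pose K : R := (2 + e) * (2 * L + 2)%:R + 2.
(* The scale for which Nn * s0 * (e / 4) exceeds the total rounding error K. *)
pose Nn : R := 4 * (K + 1) / (e * s0).
have K0 : 0 < K by rewrite ltr_wpDl // mulr_ge0 // addr_ge0 // ltW.
have Nn0 : 0 < Nn.
  apply: divr_gt0; last exact: mulr_gt0.
  by apply: mulr_gt0 => //; apply: addr_gt0 => //; exact: ltr01.
pose p x z : R := normc (fscoef (b x) z) ^+ 2.
have p0 x z : 0 <= p x z by exact: sqr_ge0.
pose a x z : nat := (Num.trunc (Nn * p x z) + (z == x))%N.
have a_le x z : (a x z)%:R <= Nn * p x z + (z == x)%:R.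
  by rewrite natrD lerD2r truncn_le mulr_ge0 // ltW.
have a_ge x z : Nn * p x z - 1 <= (a x z)%:R.
  rewrite lerBlDr natr1; apply: le_trans (ltW (truncnS_gt _)) _.
  by rewrite ler_nat ltnS leq_addr.
have a_supp x z : (0 < a x z)%N -> z \in (x |` supp (b x))%fset.
  rewrite !inE in_supp; case: (z =P x) => //= zx; apply: contraLR.
  rewrite negbK => /eqP bz; rewrite /a /p bz ComplexField.Normc.normc0 expr0n mulr0 truncn0.
  by case: (z =P x) zx.
pose A : set (X * X * nat) := [set q | (0 < q.2 <= a q.1.1 q.1.2)%N].
have fibA x : fiber A x = subgraph (a x) by [].
exists (E `|` diagonal), A; split.
- by apply: (coarse_union hC) => //; exact: coarse_diagonal hC.
- move=> [[x z] n] /= /andP[n0 na]; split=> //.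
  have := a_supp x z (leq_trans n0 na); rewrite !inE => /orP[/eqP ->|]; first by right.
  by rewrite in_supp => /bE; left.
- by move=> x; rewrite fibA; apply: finite_subgraph; exact: a_supp.
- move=> [[x z] n] [xz n1]; have {}xz : x = z := xz; have {}n1 : n = 1%N := n1.
  by rewrite /A /= /a -xz n1 eqxx addn1.
- move=> x y Txy; rewrite !fibA.
  pose F : {fset X} := ((x |` supp (b x)) `|` (y |` supp (b y)))%fset.
  have aF z : (0 < a x z)%N -> z \in F.
    by move=> /a_supp h; rewrite in_fsetU h.
  have aF' z : (0 < a y z)%N -> z \in F.
    by move=> /a_supp h; rewrite in_fsetU h orbT.
  have sF : (supp (b x) `<=` F)%fset.
    by apply/fsubsetP => z zx; rewrite !inE zx orbT.
  have sF' : (supp (b y) `<=` F)%fset.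
    by apply/fsubsetP => z zx; rewrite !inE zx !orbT.
  have sFB : (supp (b x - b y) `<=` F)%fset.
    apply/fsubsetP => z; rewrite in_supp fscoefB => h.
    have [zx|zx] := boolP (z \in supp (b x)); first by apply: (fsubsetP sF).
    apply: (fsubsetP sF'); rewrite in_supp; apply: contra h => /eqP ->.
    by move: zx; rewrite in_supp negbK => /eqP ->; rewrite subr0.
  have cardF : (#|` F| <= 2 * L + 2)%N.
    rewrite cardfsU (leq_trans (leq_subr _ _)) // !cardfsU1.
    have := suppL x; have := suppL y.
    by case: (_ \notin _); case: (_ \notin _) => /=; lia.
  apply: (subgraph_symdiff_lt aF aF').
  pose W := sqsum (fscoef (b x - b y)) F.
  pose s := sqsum (fscoef (b x)) F + sqsum (fscoef (b y)) F.
  have s_ge : s0 <= s.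
    have := bs x; rewrite (fdot_sqsum sF) lecR => h.
    by rewrite (le_trans h) // lerDl sqsum_ge0.
  have W_le : W <= 2 / c ^+ 2 * s.
    have := bT _ _ Txy; rewrite (fdot_sqsum sF) (fdot_sqsum sF') (fdot_sqsum sFB).
    by rewrite -rmorphD -rmorphM lecR.
  have sum1 w : \sum_(z <- F) ((z == w)%:R : R) <= 1.
    rewrite -natr_sum -[leRHS]/(1%:R) ler_nat -big_mkcond /= big_fset_condE /= -card_fset_sum1.
    rewrite -(cardfs1 w); apply: fsubset_leq_card; apply/fsubsetP => z.
    by rewrite !inE => /andP[].
  have up : \sum_(z <- F) (a x z)%:R + \sum_(z <- F) (a y z)%:R <= Nn * s + 2.
    have half w : \sum_(z <- F) (a w z)%:R <= Nn * sqsum (fscoef (b w)) F + 1.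
      apply: (@le_trans _ _ (\sum_(z <- F) (Nn * p w z + (z == w)%:R))).
        by apply: ler_sum => z _; exact: a_le.
      by rewrite big_split /= -mulr_sumr lerD.
    by apply: le_trans (lerD (half x) (half y)) _; rewrite /s; lra.
  have minsum : s * (1 - 2 / c) <= 2 * \sum_(z <- F) Num.min (p x z) (p y z).
    apply: (@le_trans _ _ (s - (c / 2 * W + s / c))).
      rewrite mulrBr mulr1 lerD2l lerN2.
      apply: (@le_trans _ _ (c / 2 * (2 / c ^+ 2 * s) + s / c)).
        by rewrite lerD2r; apply: ler_wpM2l => //; rewrite divr_ge0 ?(ltW c0).
      by rewrite le_eqVlt; apply/orP; left; apply/eqP; field; rewrite gt_eqF.
    rewrite /s /W /sqsum -big_split /= mulr_suml !mulr_sumr -big_split /= -sumrB.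
    apply: ler_sum => z _; apply: min_sqr_ge; rewrite ?normc_ge0 //.
    exact: (normc_dist_le (fscoef (b x) z) (fscoef (b y) z)).
  have low : Nn * (\sum_(z <- F) Num.min (p x z) (p y z)) - (2 * L + 2)%:R <=
     \sum_(z <- F) (minn (a x z) (a y z))%:R.
    apply: (@le_trans _ _ (\sum_(z <- F) (Nn * Num.min (p x z) (p y z) - 1))).
      rewrite sumrB -mulr_sumr lerD2l lerN2.
      by rewrite big_const_seq count_predT iter_addr_0 ler_nat.
    apply: ler_sum => z _.
    have [_|_] := leqP (a x z) (a y z).
      apply: le_trans (a_ge x z); rewrite lerD2r ler_pM2l //.
      by rewrite ge_min lexx.
    apply: le_trans (a_ge y z); rewrite lerD2r ler_pM2l //.
    by rewrite ge_min lexx orbT.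
  apply: le_lt_trans up _.
  apply: (@lt_le_trans _ _
    ((2 + e) * (Nn * (s * (1 - 2 / c) / 2) - (2 * L + 2)%:R))); last first.
    rewrite ler_pM2l ?addr_gt0 //; apply: le_trans low; rewrite lerD2r ler_pM2l //.
    by rewrite ler_pdivrMr // [leRHS]mulrC.
  have -> : (2 + e) * (Nn * (s * (1 - 2 / c) / 2) - (2 * L + 2)%:R) =
      Nn * s * (1 + e / 4) - (2 + e) * (2 * L + 2)%:R.
    by rewrite /c; field; rewrite !gt_eqF // addr_gt0 // mulr_gt0.
  rewrite ltrBrDr -addrA (mulrDr (Nn * s) 1) mulr1 ltrD2l.
  apply: (@lt_le_trans _ _ (Nn * s0 * (e / 4))); last first.
    by rewrite ler_pM2r ?divr_gt0 // ler_pM2l.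
  have -> : Nn * s0 * (e / 4) = K + 1 by rewrite /Nn; field; rewrite !gt_eqF.
  rewrite /K; lra.
Qed.
End FromVectors.

(** * From property A to unit vectors *)

Lemma l2_finite_support (R : realType) (X : choiceType) (f : X -> R[i]) (F : {fset X}) :
  (forall z, f z != 0 -> z \in F) -> l2 f /\ fine (l2_sqnorm f) = sqsum f F.
Proof.
move=> fF.
have le G : sqsum f G <= sqsum f F.
  suff -> : sqsum f G = sqsum f (G `&` F)%fset by apply: sqsum_mono; exact: fsubsetIr.
  rewrite /sqsum -(big_fset_incl _ (fsubsetIl G F)) // => z zG.
  rewrite inE zG /= => zF; have [->|/fF] := eqVneq (f z) 0; last by rewrite (negbTE zF).
  by rewrite ComplexField.Normc.normc0 expr0n.
have [f2 fle] := l2_bounded le; split=> //.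
by apply/eqP; rewrite eq_le fle sqsum_le_l2.
Qed.

Section Multiplicity.
Variable X : choiceType.
Implicit Types (A B : {fset X * nat}) (F : {fset X}).

Definition multiplicity A z : nat := #|` [fset p in A | p.1 == z]%fset|.

Lemma multiplicity_sub A B z : (A `<=` B)%fset -> (multiplicity A z <= multiplicity B z)%N.
Proof.
move=> /fsubsetP AB; apply: fsubset_leq_card; apply/fsubsetP => p.
by rewrite !inE => /andP[/AB -> ->].
Qed.

Lemma multiplicity_gt0 A z : (0 < multiplicity A z)%N -> exists n, (z, n) \in A.
Proof.
rewrite /multiplicity cardfs_gt0 => /fset0Pn [[y n]]; rewrite !inE => /andP[zA /eqP /= yz].
by exists n; rewrite -yz.
Qed.

Lemma sum_multiplicity A F : (forall p, p \in A -> p.1 \in F) ->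
  (\sum_(z <- F) multiplicity A z = #|` A|)%N.
Proof.
move=> AF; rewrite card_fset_sum1.
transitivity (\sum_(z <- F) \sum_(p <- A) (p.1 == z))%N.
  by apply: eq_bigr => z _; rewrite /multiplicity card_fset_sum1 -big_fset_condE /= big_mkcond.
rewrite exchange_big /=; apply: eq_big_seq => p /AF pF.
rewrite (big_fsetD1 p.1) //= eqxx big1_fset ?addn0 // => z.
by rewrite !inE eq_sym => /andP[/negbTE ->].
Qed.

End Multiplicity.

(** The geometric mean of m and m' is at least their minimum, and that of n and
    n' is at most their arithmetic mean. *)
Lemma sqrt_div_ge (R : realType) (m m' n n' : R) : 0 <= m -> 0 <= m' -> 0 < n -> 0 < n' ->
  2 * Num.min m m' / (n + n') <= Num.sqrt (m / n) * Num.sqrt (m' / n').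
Proof.
move=> m0 m0' n0 n0'; rewrite -sqrtrM ?divr_ge0 ?(ltW n0) //.
have nn : 0 < n + n' by exact: addr_gt0.
have min0 : 0 <= Num.min m m' by rewrite le_min m0.
have lhs0 : 0 <= 2 * Num.min m m' / (n + n') by rewrite divr_ge0 ?mulr_ge0 ?(ltW nn).
rewrite -(ger0_norm lhs0) -sqrtr_sqr ler_wsqrtr //.
rewrite mulf_div expr_div_n ler_pdivrMr ?exprn_gt0 // mulrAC ler_pdivlMr ?mulr_gt0 //.
apply: (@le_trans _ _ (m * m' * (4 * (n * n')))).
  have -> : (2 * Num.min m m') ^+ 2 * (n * n') = Num.min m m' ^+ 2 * (4 * (n * n')) by ring.
  rewrite ler_wpM2r ?mulr_ge0 ?(ltW n0) ?(ltW n0') // expr2.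
  by rewrite ler_pM // ge_min lexx ?orbT.
apply: ler_wpM2l; first exact: mulr_ge0.
by rewrite -subr_ge0 (_ : _ - _ = (n - n') ^+ 2) ?sqr_ge0 //; ring.
Qed.

Section AToVectors.
Variables (R : realType) (X : choiceType) (C : set (set (X * X))).
Hypothesis hC : coarse_structure C.

(** The vector at x is the square root of the distribution on X of the first
    component of a uniform element of A_x.  The overlap of two such vectors is
    at least 2 #(A_x & A_y) / (#A_x + #A_y), which property A bounds below by
    2 / (2 + e^2); hence their squared distance is less than e^2. *)
Lemma unit_vectors_of_property_A : property_A R C ->
  forall (e : R) (T : set (X * X)), 0 < e -> C T ->
    exists eta : X -> (X -> R[i]),
      [/\ forall x, l2 (eta x),
          forall x, l2_norm (eta x) = 1,
          forall x y, T (x, y) -> l2_norm (eta x - eta y) < e &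
          C [set xy | eta xy.1 xy.2 != 0]].
Proof.
move=> propA e T e0 CT.
have [S [A [CS AS finA diagA smallA]]] := propA (e ^+ 2) T (exprn_gt0 2 e0) CT.
pose B x := fset_set (fiber A x).
have inB x p : (p \in B x) = (p \in fiber A x) by rewrite in_fset_set.
have B0 x : (0 < #|` B x|)%N.
  rewrite cardfs_gt0; apply/fset0Pn; exists (x, 1%N); rewrite inB inE.
  by apply: diagA.
pose m x z : R := (multiplicity (B x) z)%:R.
pose n x : R := (#|` B x|)%:R.
have n0 x : 0 < n x by rewrite ltr0n.
have m0 x z : 0 <= m x z by rewrite ler0n.
pose r x z : R := Num.sqrt (m x z / n x).
pose eta x z : R[i] := (r x z)%:C.
have r0 x z : 0 <= r x z by exact: sqrtr_ge0.
pose F x : {fset X} := [fset p.1 | p in B x]%fset.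
have FB x p : p \in B x -> p.1 \in F x by move=> pB; apply/imfsetP; exists p.
have etaF x z : eta x z != 0 -> z \in F x /\ S (x, z).
  move=> h; have : (0 < multiplicity (B x) z)%N.
    rewrite lt0n; apply: contra h => /eqP h.
    by rewrite /eta /r /m h mul0r sqrtr0.
  move=> /multiplicity_gt0 [i zi]; split; first exact: (FB _ _ zi).
  by move: zi; rewrite inB inE => /AS [].
have sumr x (G : {fset X}) : (forall z, z \in F x -> z \in G) ->
    \sum_(z <- G) r x z ^+ 2 = 1.
  move=> FG; under eq_bigr do rewrite sqr_sqrtr ?divr_ge0 ?(ltW (n0 x)) //.
  rewrite -mulr_suml -natr_sum sum_multiplicity => [|p /FB /FG //].
  by rewrite mulfV // gt_eqF //; exact: n0.
have normr_ (t : R) : normc t%:C ^+ 2 = t ^+ 2 by rewrite normc_sqr /= expr0n addr0.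
exists eta; split.
- by move=> x; have [] := @l2_finite_support _ _ (eta x) (F x) (fun z h => (etaF x z h).1).
- move=> x; have [_ h] := @l2_finite_support _ _ (eta x) (F x) (fun z h => (etaF x z h).1).
  rewrite /l2_norm h /sqsum; under eq_bigr do rewrite normr_.
  by rewrite sumr // sqrtr1.
- move=> x y Txy; pose G := (F x `|` F y)%fset.
  have supG z : (eta x - eta y) z != 0 -> z \in G.
    move=> h; rewrite in_fsetU.
    have [hx|/etaF [-> //]] := eqVneq (eta x z) 0.
    have [hy|/etaF [-> //]] := eqVneq (eta y z) 0; last by rewrite orbT.
    by move: h; rewrite !fctE hx hy subrr eqxx.
  have [_ h] := l2_finite_support supG.
  rewrite /l2_norm h -[ltRHS]gtr0_norm // -sqrtr_sqr ltr_sqrt ?exprn_gt0 //.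
  pose c : R := (#|` (B x `&` B y)%fset|)%:R.
  have c0 : n x + n y < (2 + e ^+ 2) * c.
    have := smallA x y Txy; rewrite fset_setI // -/(B x) -/(B y) -/c mulrDl => h1.
    have := card_symdiff (finA x) (finA y); rewrite -/(B x) -/(B y) => h2.
    by rewrite -natrD -h2 natrD natrM fset_setI // -/(B x) -/(B y) -/c addrC ltrD2l.
  have minc : c <= \sum_(z <- G) Num.min (m x z) (m y z).
    rewrite /c -(@sum_multiplicity _ _ G) => [|p]; last first.
      by rewrite in_fsetI => /andP[/FB h1 _]; rewrite in_fsetU h1.
    rewrite natr_sum; apply: ler_sum => z _.
    by rewrite le_min !ler_nat !multiplicity_sub ?fsubsetIl ?fsubsetIr.
  have E : sqsum (eta x - eta y) G = 2 - 2 * \sum_(z <- G) r x z * r y z.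
    have Gx : \sum_(z <- G) r x z ^+ 2 = 1 by apply: sumr => z zF; rewrite in_fsetU zF.
    have Gy : \sum_(z <- G) r y z ^+ 2 = 1 by apply: sumr => z zF; rewrite in_fsetU zF orbT.
    transitivity (\sum_(z <- G) r x z ^+ 2 + \sum_(z <- G) r y z ^+ 2
      - 2 * \sum_(z <- G) r x z * r y z); last by rewrite Gx Gy.
    rewrite mulr_sumr -big_split -sumrB; apply: eq_bigr => z _ /=.
    have h2 : normc ((eta x - eta y) z) ^+ 2 = (r x z - r y z) ^+ 2.
      by rewrite -normr_ rmorphB.
    by rewrite [LHS]h2; ring.
  rewrite E.
  have ge : 2 * c / (n x + n y) <= \sum_(z <- G) r x z * r y z.
    apply: (@le_trans _ _ (\sum_(z <- G) 2 * Num.min (m x z) (m y z) / (n x + n y))).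
      rewrite -mulr_suml -mulr_sumr ler_pM2r ?invr_gt0 ?addr_gt0 //.
      by rewrite ler_pM2l.
    by apply: ler_sum => z _; exact: sqrt_div_ge.
  have nn : 0 < n x + n y by exact: addr_gt0.
  have cpos : 0 < c.
    rewrite -(@pmulr_rgt0 _ (2 + e ^+ 2)) ?addr_gt0 ?exprn_gt0 //.
    exact: lt_trans c0.
  have : 2 - e ^+ 2 < 2 * (2 * c / (n x + n y)).
    rewrite mulrA ltr_pdivlMr //.
    have [e2|e2] := leP (2 - e ^+ 2) 0.
      by apply: (@le_lt_trans _ _ 0); rewrite ?mulr_gt0 // mulr_le0_ge0 // ltW.
    apply: (@lt_le_trans _ _ ((2 - e ^+ 2) * ((2 + e ^+ 2) * c))); first by rewrite ltr_pM2l.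
    rewrite -subr_ge0.
    have -> : 2 * (2 * c) - (2 - e ^+ 2) * ((2 + e ^+ 2) * c) = e ^+ 4 * c by ring.
    by rewrite mulr_ge0 ?exprn_ge0 ?(ltW e0) ?(ltW cpos).
  by move=> h1; rewrite ltrBlDr -ltrBlDl; apply: lt_le_trans h1 _; rewrite ler_pM2l.
- by apply: (coarse_subset hC _ CS) => -[x z] /= /etaF [].
Qed.
End AToVectors.

(** * The equivalence *)

(** Two vectors can only have a nonzero inner product when their supports meet,
    which relates their indices by a composition of controlled sets. *)
Lemma hilbert_vectors_of_l2_vectors (R : realType) (X : choiceType) (C : set (set (X * X)))
    (hC : coarse_structure C) (e : R) (T : set (X * X)) (eta : X -> (X -> R[i])) :
  (forall x, l2 (eta x)) -> (forall x, l2_norm (eta x) = 1) ->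
  (forall x y, T (x, y) -> l2_norm (eta x - eta y) < e) ->
  C [set xy | eta xy.1 xy.2 != 0] ->
  exists (H : hilbertSpace R) (xi : X -> H),
    [/\ forall x, `|xi x| = 1,
        forall x y, T (x, y) -> `|xi x - xi y| < e%:C &
        C [set xy | inner H (xi xy.2) (xi xy.1) != 0]].
Proof.
move=> eta2 eta1 etaT etaC.
have eta2' x : eta x \in @l2pred R X by apply/asboolP.
pose xi x : l2hilbert R X := L2 (eta2' x).
have normE (u : l2space R X) : `|u| = (l2_norm (l2fun u))%:C by exact: l2space_normE.
exists (l2hilbert R X), xi; split.
- by move=> x; apply: etrans (normE _) _; rewrite /= eta1.
- move=> x y /etaT h.
  apply: (@le_lt_trans _ _ (l2_norm (eta x - eta y))%:C); last by rewrite ltcR.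
  by rewrite le_eqVlt; apply/orP; left; apply/eqP; exact: normE.
- apply: (coarse_subset hC _ (coarse_compose hC etaC (coarse_inverse hC etaC))).
  move=> [x y] /= h; apply: contrapT => nh; move/eqP: h; apply.
  apply: (@l2ip_disjoint _ _ (eta y) (eta x)) => z.
  have [->|yz] := eqVneq (eta y z) 0; first by rewrite mul0r.
  have [->|xz] := eqVneq (eta x z) 0; first by rewrite conjC0 mulr0.
  by case: nh; exists z.
Qed.

(** A Gram matrix is positive definite, and 1 - <xi y, xi x> = <xi x - xi y, xi x>
    is controlled by the Cauchy-Schwarz inequality. *)
Lemma kernel_of_hilbert_vectors (R : realType) (X : choiceType) (C : set (set (X * X)))
    (e : R) (T : set (X * X)) (H : hilbertSpace R) (xi : X -> H) :
  (forall x, `|xi x| = 1) ->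
  (forall x y, T (x, y) -> `|xi x - xi y| < e%:C) ->
  C [set xy | inner H (xi xy.2) (xi xy.1) != 0] ->
  exists k : X * X -> R[i],
    [/\ positive_definite_kernel k,
        forall x y, T (x, y) -> `|1 - k (x, y)| < e%:C &
        C [set xy | k xy != 0]].
Proof.
move=> xi1 xiT xiC; exists (fun xy => inner H (xi xy.2) (xi xy.1)); split=> //.
- move=> n x l /=.
  suff -> : \sum_(i < n) \sum_(j < n) (l i)^* * l j * inner H (xi (x j)) (xi (x i)) =
    inner H (\sum_(j < n) l j *: xi (x j)) (\sum_(j < n) l j *: xi (x j)).
    exact: dnorm_ge0.
  rewrite linear_sumr; apply: eq_bigr => i _ /=.
  rewrite linear_sumlz; apply: eq_bigr => j _ /=.
  by rewrite [RHS]linearZr_LR /= [X in _ = _ * X]linearZl_LR /= mulrA.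
- move=> x y /xiT h /=.
  have n1 z : sqrtC (inner H (xi z) (xi z)) = 1 by rewrite -inner_norm xi1 expr1n sqrtC1.
  have -> : 1 - inner H (xi y) (xi x) = inner H (xi x - xi y) (xi x).
    by rewrite linearBl /= -[in RHS]inner_norm xi1 expr1n.
  apply: le_lt_trans (dot_Cauchy_Schwarz _ _ _) _.
  by rewrite n1 mulr1 -inner_norm sqrCK.
Qed.

Theorem theorem3p1 (R : realType) (X : choiceType) (C : set (set (X * X)))
    (hC : coarse_structure C) (hX : uniformly_locally_finite C) :
  [<-> property_A R C;
       forall (e : R) (T : set (X * X)), 0 < e -> C T ->
         exists eta : X -> (X -> R[i]),
           [/\ forall x, l2 (eta x),
               forall x, l2_norm (eta x) = 1,
               forall x y, T (x, y) -> l2_norm (eta x - eta y) < e &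
               C [set xy | eta xy.1 xy.2 != 0]];
       forall (e : R) (T : set (X * X)), 0 < e -> C T ->
         exists (H : hilbertSpace R) (eta : X -> H),
           [/\ forall x, `|eta x| = 1,
               forall x y, T (x, y) -> `|eta x - eta y| < e%:C &
               C [set xy | inner H (eta xy.2) (eta xy.1) != 0]];
       forall (e : R) (T : set (X * X)), 0 < e -> C T ->
         exists k : X * X -> R[i],
           [/\ positive_definite_kernel k,
               forall x y, T (x, y) -> `|1 - k (x, y)| < e%:C &
               C [set xy | k xy != 0]]].
Proof.
tfae.
- exact: unit_vectors_of_property_A hC.
- move=> H2 e T e0 CT; have [eta [h1 h2 h3 h4]] := H2 e T e0 CT.
  exact: (hilbert_vectors_of_l2_vectors hC h1 h2 h3 h4).
- move=> H3 e T e0 CT; have [H [eta [h1 h2 h3]]] := H3 e T e0 CT.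
  exact: (kernel_of_hilbert_vectors h1 h2 h3).
- move=> H4; apply: (property_A_of_vectors hC hX).
  exact: (almost_invariant_vectors_of_kernels hC hX H4).
Qed.
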